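(* Let $0<\alpha<2$ and let $\delta=\delta(\alpha)=\min\{1/4,(3C)^{-1/(1+\alpha)}\}$ with $C=2^{\alpha+1}(1+2\alpha)$. Let $\rho$ be a classical solution on $\mathbb{T}\times[0,\infty)$ of $\partial_t\rho+\partial_x(\rho u)=0$, $u=H\Lambda^{\alpha-1}\rho$, with smooth $1$-periodic initial datum $\rho_0$ satisfying (H1), (H2), (H3). Then $u(x,t)\le0$ for all $x\in[0,\delta]$ and all $t\ge0$.
   Context: $\mathbb{T}=\mathbb{R}/\mathbb{Z}$ identified with $[-1/2,1/2)$; functions on $\mathbb{T}$ are identified with their $1$-periodic extensions. $u(x,t)=c_\alpha\,\mathrm{P.V.}\int_{\mathbb{R}}\frac{\rho(y,t)-\rho(x,t)}{\mathrm{sgn}(x-y)|x-y|^{\alpha}}dy$ with $c_\alpha>0$ the constant for which $\Lambda^\alpha f(x)=c_\alpha\,\mathrm{P.V.}\int_{\mathbb{R}}\frac{f(x)-f(y)}{|x-y|^{1+\alpha}}dy$. (H1) $\rho_0(x)=\rho_0(-x)$; (H2) $0\le\rho_0\le\rho_{\max}$ for a constant $\rho_{\max}>0$; (H3) $\rho_0(0)=0$ and $\partial_x\rho_0\ge0$ on $[0,1/2]$. *)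

(* Defs.v *)
From Stdlib Require Import Reals Lra.
Open Scope R_scope.

Definition periodic1 (f : R -> R) : Prop := forall x, f (x + 1) = f x.

Definition smooth (f : R -> R) : Prop :=
  exists d : nat -> R -> R, d 0%nat = f /\
    forall n x, derivable_pt_lim (d n) x (d (S n) x).

Definition Rsgn (z : R) : R :=
  if Rlt_dec 0 z then 1 else if Rlt_dec z 0 then -1 else 0.

Definition integral_is (f : R -> R) (a b v : R) : Prop :=
  exists pr : Riemann_integrable f a b, RiemannInt pr = v.

Definition trunc_integral_is (g : R -> R) (x eps Rr v : R) : Prop :=
  exists v1 v2, integral_is g (x - Rr) (x - eps) v1 /\
                integral_is g (x + eps) (x + Rr) v2 /\ v = v1 + v2.

Definition pv_integral_is (g : R -> R) (x L : R) : Prop :=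
  (forall eps Rr, 0 < eps < Rr -> exists v, trunc_integral_is g x eps Rr v) /\
  forall eta, 0 < eta -> exists e0 R0, 0 < e0 /\ 0 < R0 /\
    forall eps Rr v, 0 < eps < e0 -> R0 < Rr -> trunc_integral_is g x eps Rr v ->
      Rabs (v - L) < eta.

Definition vel_kernel (alpha : R) (f : R -> R) (x : R) : R -> R :=
  fun y => (f y - f x) / (Rsgn (x - y) * Rpower (Rabs (x - y)) alpha).

Definition velocity_is (alpha c : R) (f : R -> R) (x v : R) : Prop :=
  exists L, pv_integral_is (vel_kernel alpha f x) x L /\ v = c * L.

Definition cont2_at (f : R -> R -> R) (x t : R) : Prop :=
  forall eps, 0 < eps -> exists d, 0 < d /\
    forall y s, Rabs (y - x) < d -> Rabs (s - t) < d -> Rabs (f y s - f x t) < eps.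

Definition classical_solution (alpha c : R) (rho0 : R -> R)
    (rho u : R -> R -> R) : Prop :=
  (forall x, rho x 0 = rho0 x) /\
  (forall x t, 0 <= t -> rho (x + 1) t = rho x t) /\
  (forall x t, 0 <= t -> cont2_at rho x t) /\
  (exists rx : R -> R -> R,
     (forall x t, 0 <= t -> derivable_pt_lim (fun y => rho y t) x (rx x t)) /\
     (forall x t, 0 <= t -> cont2_at rx x t)) /\
  (exists rt : R -> R -> R,
     (forall x t, 0 < t -> derivable_pt_lim (fun s => rho x s) t (rt x t)) /\
     (forall x t, 0 < t -> cont2_at rt x t)) /\
  (forall x t, 0 <= t -> velocity_is alpha c (fun y => rho y t) x (u x t)) /\
  (forall x t, 0 < t -> exists a b,
     derivable_pt_lim (fun s => rho x s) t a /\
     derivable_pt_lim (fun y => rho y t * u y t) x b /\ a + b = 0).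

Definition Cconst (alpha : R) : R := Rpower 2 (alpha + 1) * (1 + 2 * alpha).

Definition delta (alpha : R) : R :=
  Rmin (1/4) (Rpower (3 * Cconst alpha) (- (1 / (1 + alpha)))).

(* Main.v *)
Require Import Defs.
From Stdlib Require Import Reals Lra Lia ZArith ClassicalEpsilon.
From Coquelicot Require Import Coquelicot.
Open Scope R_scope.

(** Let [V] be the integral of [rho] over [[0, x]]. Up to a function of time alone [V_t = - rho u],
    and since [u x] is [- c] times the principal value of the integral of
    [(rho (x + s) - rho (x - s)) / s ^ alpha] over [s > 0], [u] is a positive multiple of the
    fractional Laplacian of [V]. Differences of values of [V] therefore obey a minimum principle:
    at a critical point the values of [rho] involved coincide, so the time derivative is [- rho]
    times a combination of velocities whose sign is known. The principle is applied to
    [V (x + h) - V x], which gives [rho >= 0]; to the oscillation of [V x + V (- x)], which keeps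
    [rho] even; and to [V (x + z) + V (x - z) - 2 V x] for [x] in [[0, 1/2]], an odd periodic
    function of [x], for which the nonlocal operator is folded onto [[0, 1/2]]. Nonnegativity of
    the last quantity gives [u <= 0] on all of [[0, 1/2]], which contains [[0, delta]]. Arguing on
    [V] instead of [rho] is what makes [C^1] regularity of [rho] sufficient when [alpha >= 1]. *)

(** * One-dimensional integrals *)

Lemma is_derive_continuous (f : R -> R) (x l : R) : is_derive f x l -> continuous f x.
Proof. intros H. apply (ex_derive_continuous f x). now exists l. Qed.

Lemma ex_RInt_cont (f : R -> R) (a b : R) : (forall x, continuous f x) -> ex_RInt f a b.
Proof. intros H. apply (@ex_RInt_continuous R_CompleteNormedModule). auto. Qed.

Lemma RInt_split (f : R -> R) (a b c : R) :
  ex_RInt f a b -> ex_RInt f b c -> RInt f a c = RInt f a b + RInt f b c.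
Proof. intros H1 H2. symmetry. apply (RInt_Chasles f a b c H1 H2). Qed.

Lemma RInt_ext_le (f g : R -> R) (a b : R) : a <= b ->
  (forall x, a < x < b -> f x = g x) -> RInt f a b = RInt g a b.
Proof.
  intros Hab H. apply RInt_ext. now rewrite Rmin_left, Rmax_right.
Qed.

Lemma RInt_of_derive (f df : R -> R) (a b : R) : a <= b ->
  (forall x, a <= x <= b -> is_derive f x (df x)) ->
  (forall x, a <= x <= b -> continuous df x) ->
  RInt df a b = f b - f a.
Proof.
  intros Hab H1 H2. apply is_RInt_unique.
  apply (@is_RInt_derive R_CompleteNormedModule f df a b);
    rewrite Rmin_left, Rmax_right; auto.
Qed.

Lemma RInt_reflect (f : R -> R) (c a b : R) :
  ex_RInt f (c - b) (c - a) -> RInt (fun s => f (c - s)) a b = RInt f (c - b) (c - a).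
Proof.
  intros H.
  assert (H' : ex_RInt f (-1 * a + c) (-1 * b + c)).
  { replace (-1 * a + c) with (c - a) by ring. replace (-1 * b + c) with (c - b) by ring.
    now apply ex_RInt_swap. }
  generalize (RInt_comp_lin f (-1) c a b H').
  replace (-1 * a + c) with (c - a) by ring. replace (-1 * b + c) with (c - b) by ring.
  rewrite <- (opp_RInt_swap f (c - b) (c - a)) by exact H.
  intros H2.
  assert (H3 : RInt (fun y => scal (-1) (f (-1 * y + c))) a b
     = - RInt (fun s => f (c - s)) a b).
  { transitivity (RInt (fun y => -1 * f (c - y)) a b).
    - apply RInt_ext. intros y _. unfold scal; simpl. unfold mult; simpl.
      f_equal. f_equal. ring.
    - replace (- RInt (fun s => f (c - s)) a b)
        with (scal (-1) (RInt (fun s => f (c - s)) a b))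
        by (unfold scal; simpl; unfold mult; simpl; ring).
      apply (RInt_scal (fun s => f (c - s)) a b (-1)).
      apply (ex_RInt_ext (fun y => scal (-1) (scal (-1) (f (-1 * y + c))))).
      + intros y _. unfold scal; simpl; unfold mult; simpl.
        replace (-1 * y + c) with (c - y) by ring. ring.
      + apply (@ex_RInt_scal R_NormedModule (fun y => scal (-1) (f (-1 * y + c)))). apply (ex_RInt_comp_lin f (-1) c a b H'). }
  assert (E : - RInt (fun s => f (c - s)) a b = - RInt f (c - b) (c - a))
    by (rewrite <- H3; exact H2).
  lra.
Qed.

Lemma RInt_shift (f : R -> R) (c a b : R) :
  ex_RInt f (a + c) (b + c) -> RInt (fun s => f (s + c)) a b = RInt f (a + c) (b + c).
Proof.
  intros H.
  replace (a + c) with (1 * a + c) in * by ring. replace (b + c) with (1 * b + c) in * by ring.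
  rewrite <- (RInt_comp_lin f 1 c a b H).
  apply RInt_ext. intros y _. unfold scal; simpl; unfold mult; simpl.
  replace (1 * y + c) with (y + c) by ring. ring.
Qed.

(** By the mean value theorem [F s] is [s] times a value of [f] at a smaller point. The factor
    [1 / (n + 1)] is given up, since only the order of vanishing at 0 matters later. *)
Lemma bound_power_primitive (n : nat) (F f : R -> R) (C : R) :
  F 0 = 0 -> (forall s, is_derive F s (f s)) ->
  (forall s, 0 <= s <= 1 -> Rabs (f s) <= C * s ^ n) ->
  forall s, 0 <= s <= 1 -> Rabs (F s) <= C * s ^ S n.
Proof.
  intros F0 dF Hf s Hs.
  destruct (MVT_gen F 0 s f) as [c [Hc Heq]].
  - intros; apply dF.
  - intros x _. apply continuity_pt_filterlim. exact (is_derive_continuous _ _ _ (dF x)).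
  - rewrite Rmin_left, Rmax_right in Hc by lra.
    replace (F s) with (f c * s) by (rewrite F0 in Heq; lra).
    rewrite Rabs_mult, (Rabs_pos_eq s) by lra.
    assert (0 <= C) by (specialize (Hf 1 ltac:(lra)); rewrite pow1 in Hf;
      generalize (Rabs_pos (f 1)); lra).
    assert (Rabs (f c) <= C * s ^ n).
    { apply Rle_trans with (1 := Hf c ltac:(lra)).
      apply Rmult_le_compat_l; [easy|]. apply pow_incr. lra. }
    simpl. replace (C * (s * s ^ n)) with (C * s ^ n * s) by ring.
    apply Rmult_le_compat_r; lra.
Qed.

(** * Sign of the principal value *)

(* Two integrations by parts move both derivatives onto the weight; the reflection s -> 1 - s
   then pairs the values of the second primitive near 1 with larger weights near 0. *)
Lemma weighted_integral_lower_bound (g phi w w1 w2 : R -> R) (C eps : R) :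
  0 <= eps <= 1/2 ->
  (forall s, is_derive phi s (g s)) -> (forall s, continuous g s) ->
  phi 0 = 0 -> (forall s, phi (s + 1) = phi s) -> (forall s, phi (- s) = phi s) ->
  (forall r, 0 <= r <= 1/2 -> 0 <= RInt phi 0 r) ->
  (forall s, 0 <= s <= 1 -> Rabs (g s) <= C * s) ->
  (forall s, eps <= s <= 1 -> is_derive w s (w1 s)) ->
  (forall s, eps <= s <= 1 -> is_derive w1 s (w2 s)) ->
  (forall s, eps <= s <= 1 -> continuous w2 s) ->
  w1 1 <= 0 -> (forall s, eps <= s <= 1 -> 0 <= w2 s) ->
  (forall s s', eps <= s -> s <= s' -> s' <= 1 -> w2 s' <= w2 s) ->
  - (C * eps ^ 2 * Rabs (w eps) + C * eps ^ 3 * Rabs (w1 eps) + C * eps ^ 4 * w2 (1/2))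
    <= RInt (fun s => g s * w s) eps 1.
Proof.
  intros He dphi cg phi0 phiP phiE HPhi Hg dw dw1 cw2 Hw1 Hw2 Hw2m.
  pose (Phi r := RInt phi 0 r).
  assert (cphi : forall s, continuous phi s) by (intros s; exact (is_derive_continuous _ _ _ (dphi s))).
  assert (dPhi : forall s, is_derive Phi s (phi s)).
  { intros s. apply (is_derive_RInt phi Phi 0 s); [|apply cphi].
    apply filter_forall. intros b. apply (@RInt_correct R_CompleteNormedModule).
    now apply ex_RInt_cont. }
  assert (Phi0 : Phi 0 = 0) by (apply (RInt_point 0 phi)).
  assert (bphi : forall s, 0 <= s <= 1 -> Rabs (phi s) <= C * s ^ 2).
  { apply (bound_power_primitive 1 phi g); auto.
    intros s Hs. rewrite pow_1. auto. }
  assert (bPhi : forall s, 0 <= s <= 1 -> Rabs (Phi s) <= C * s ^ 3)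
    by (apply (bound_power_primitive 2 Phi phi); auto).
  (* [phi] is even and 1-periodic, hence symmetric about [1/2]. At [s = 1/2] this gives
     [Phi 1 = 2 * Phi (1/2)], which is nonnegative. *)
  assert (PhiR : forall s, Phi (1 - s) = Phi 1 - Phi s).
  { intros s. unfold Phi. rewrite (RInt_split phi 0 (1 - s) 1) by (now apply ex_RInt_cont).
    assert (RInt phi (1 - s) 1 = RInt phi 0 s); [|lra].
    transitivity (RInt (fun r => phi (1 - r)) 0 s).
    - rewrite (RInt_reflect phi 1 0 s) by (now apply ex_RInt_cont). f_equal; ring.
    - apply RInt_ext. intros r _. rewrite <- (phiE r), <- (phiP (- r)). f_equal; ring. }
  assert (Phi1 : 0 <= Phi 1).
  { generalize (PhiR (1/2)) (HPhi (1/2) ltac:(lra)). fold (Phi (1/2)).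
    replace (1 - 1/2) with (1/2) by field. lra. }
  assert (C0 : 0 <= C).
  { generalize (Hg 1 ltac:(lra)) (Rabs_pos (g 1)). lra. }
  assert (phi1 : phi 1 = 0) by (rewrite <- phi0, <- (phiP 0); f_equal; ring).
  pose (Pw s := Phi s * w2 s).
  assert (cPw : forall s, eps <= s <= 1 -> continuous Pw s).
  { intros s Hs. apply (continuous_mult Phi w2); auto.
    exact (is_derive_continuous _ _ _ (dPhi s)). }
  assert (cgw : forall s, eps <= s <= 1 -> continuous (fun s => g s * w s) s).
  { intros s Hs. apply (continuous_mult g w); auto.
    exact (is_derive_continuous _ _ _ (dw s Hs)). }
  assert (exP : forall a b, eps <= a <= 1 -> eps <= b <= 1 -> ex_RInt Pw a b).
  { intros a b Ha Hb. apply (@ex_RInt_continuous R_CompleteNormedModule). intros z Hz. apply cPw.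
    revert Hz. unfold Rmin, Rmax. destruct (Rle_dec a b); lra. }
  assert (IBP : RInt (fun s => g s * w s) eps 1
     = (- Phi 1 * w1 1) - (phi eps * w eps - Phi eps * w1 eps) + RInt Pw eps 1).
  (* [phi * w - Phi * w1] is a primitive of [g * w - Phi * w2]. The term [phi 1 * w 1] vanishes and
     [- Phi 1 * w1 1] has the good sign, so only the boundary terms at [eps] and the integral of
     [Pw] need bounds. *)
  { assert (E : RInt (fun s => g s * w s - Pw s) eps 1 =
       (phi 1 * w 1 - Phi 1 * w1 1) - (phi eps * w eps - Phi eps * w1 eps)).
    { apply (RInt_of_derive (fun s => phi s * w s - Phi s * w1 s)); [lra| |].
      - intros s Hs.
        assert (Ha := is_derive_mult phi w s _ _ (dphi s) (dw s Hs) Rmult_comm).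
        assert (Hb := is_derive_mult Phi w1 s _ _ (dPhi s) (dw1 s Hs) Rmult_comm).
        assert (Hc := is_derive_minus _ _ _ _ _ Ha Hb).
        revert Hc. unfold minus, plus, mult, opp; simpl. unfold mult; simpl.
        intros Hc. match type of Hc with is_derive _ _ ?l => replace (g s * w s - Pw s) with l by (unfold Pw; ring) end.
        exact Hc.
      - intros s Hs. apply (continuous_minus (fun s => g s * w s) Pw); auto. }
    assert (M : RInt (fun s => g s * w s - Pw s) eps 1
       = RInt (fun s => g s * w s) eps 1 - RInt Pw eps 1).
    { apply (RInt_minus (fun s => g s * w s) Pw).
      - apply (@ex_RInt_continuous R_CompleteNormedModule). intros z Hz. apply cgw.
        revert Hz. rewrite Rmin_left, Rmax_right by lra. lra.
      - apply exP; lra. }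
    rewrite phi1 in E. lra. }
  (* On [[1/2, 1 - eps]] one has [Phi s >= - Phi (1 - s)], while [w2 s <= w2 (1 - s)], so this piece
     is compensated by [[eps, 1/2]]. The piece [[1 - eps, 1]] has no partner; there
     [Phi s >= - C * eps ^ 3] on a length [eps]. *)
  assert (LB : - (C * eps ^ 4 * w2 (1/2)) <= RInt Pw eps 1).
  { rewrite (RInt_split Pw eps (1/2) 1) by (apply exP; lra).
    rewrite (RInt_split Pw (1/2) (1 - eps) 1) by (apply exP; lra).
    assert (H1 : - RInt Pw eps (1/2) <= RInt Pw (1/2) (1 - eps)).
    { assert (exR : ex_RInt (fun s => Pw (1 - s)) (1/2) (1 - eps)).
      { apply (@ex_RInt_continuous R_CompleteNormedModule). intros z Hz.
        rewrite Rmin_left, Rmax_right in Hz by lra.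
        apply (continuous_comp (fun s => 1 - s) Pw); [|apply cPw; lra].
        apply (continuous_minus (fun _ => 1) (fun s => s)); [apply continuous_const|apply continuous_id]. }
      replace (RInt Pw eps (1/2)) with (RInt (fun s => Pw (1 - s)) (1/2) (1 - eps)).
      2:{ rewrite RInt_reflect; [f_equal; lra|apply exP; lra]. }
      change (opp (RInt (fun s => Pw (1 - s)) (1/2) (1 - eps)) <= RInt Pw (1/2) (1 - eps)).
      rewrite <- (RInt_opp (fun s => Pw (1 - s))) by exact exR.
      apply RInt_le; [lra| |apply exP; lra|].
      - now apply (ex_RInt_opp (fun s => Pw (1 - s))).
      - intros s Hs. unfold opp; simpl. unfold Pw.
        assert (0 <= Phi (1 - s)) by (apply HPhi; lra).
        assert (w2 s <= w2 (1 - s)) by (apply Hw2m; lra).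
        assert (0 <= w2 s) by (apply Hw2; lra).
        generalize (PhiR (1 - s)). replace (1 - (1 - s)) with s by ring. intros E.
        nra. }
    assert (H2 : - (C * eps ^ 4 * w2 (1/2)) <= RInt Pw (1 - eps) 1).
    { replace (- (C * eps ^ 4 * w2 (1/2))) with (RInt (fun _ => - (C * eps ^ 3 * w2 (1/2))) (1 - eps) 1).
      2:{ rewrite RInt_const. unfold scal; simpl; unfold mult; simpl. ring. }
      apply RInt_le; [lra|apply ex_RInt_const|apply exP; lra|].
      intros s Hs. unfold Pw.
      assert (HB := bPhi (1 - s) ltac:(lra)).
      assert (C * (1 - s) ^ 3 <= C * eps ^ 3)
        by (apply Rmult_le_compat_l; [easy|apply pow_incr; lra]).
      assert (0 <= C * eps ^ 3) by (apply Rmult_le_pos; [easy|apply pow_le; lra]).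
      generalize (PhiR (1 - s)). replace (1 - (1 - s)) with s by ring. intros E.
      assert (0 <= w2 s) by (apply Hw2; lra).
      assert (w2 s <= w2 (1/2)) by (apply Hw2m; lra).
      assert (- (C * eps ^ 3) <= Phi s).
      { generalize (Rle_abs (Phi (1 - s))). lra. }
      nra. }
    lra. }
  assert (B1 : phi eps * w eps <= C * eps ^ 2 * Rabs (w eps)).
  { apply Rle_trans with (1 := Rle_abs _). rewrite Rabs_mult.
    apply Rmult_le_compat_r; [apply Rabs_pos|apply bphi; lra]. }
  assert (B2 : - (Phi eps * w1 eps) <= C * eps ^ 3 * Rabs (w1 eps)).
  { apply Rle_trans with (1 := Rle_abs _). rewrite Rabs_Ropp, Rabs_mult.
    apply Rmult_le_compat_r; [apply Rabs_pos|apply bPhi; lra]. }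
  assert (0 <= - Phi 1 * w1 1) by nra.
  lra.
Qed.

(** * Real powers as weights *)

Lemma is_derive_Rpower_shift (y a s : R) : 0 < s + a ->
  is_derive (fun x => Rpower (x + a) y) s (y * Rpower (s + a) (y - 1)).
Proof.
  intros Hs.
  replace (y * Rpower (s + a) (y - 1)) with (scal 1 (y * Rpower (s + a) (y - 1)))
    by (unfold scal; simpl; unfold mult; simpl; ring).
  apply (is_derive_comp (fun x => Rpower x y) (fun x => x + a)).
  - apply is_derive_Reals. now apply derivable_pt_lim_power.
  - replace 1 with (1 + 0) by ring.
    apply (is_derive_plus (fun x => x) (fun _ => a)).
    + apply (is_derive_id (K := R_AbsRing)).
    + apply (is_derive_const (K := R_AbsRing) (V := R_NormedModule)).
Qed.

Lemma Rpower_antitone (y a b : R) : 0 <= y -> 0 < a <= b -> Rpower b (- y) <= Rpower a (- y).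
Proof.
  intros Hy Hab. rewrite !Rpower_Ropp.
  apply Rinv_le_contravar; [apply exp_pos|]. now apply Rle_Rpower_l.
Qed.

Lemma Rpower_small (p eta : R) : 0 < p -> 0 < eta ->
  exists e, 0 < e /\ forall x, 0 < x < e -> Rpower x p < eta.
Proof.
  intros Hp He. exists (Rpower eta (/ p)). split; [apply exp_pos|].
  intros x Hx. replace eta with (Rpower (Rpower eta (/ p)) p).
  - now apply Rlt_Rpower_l.
  - rewrite Rpower_mult, Rinv_l by lra. now apply Rpower_1.
Qed.

Lemma Rpower_pow_opp (e : R) (n : nat) (a : R) : 0 < e ->
  e ^ n * Rpower e (- a) = Rpower e (INR n - a).
Proof.
  intros He. rewrite <- (Rpower_pow n e He), <- Rpower_plus. reflexivity.
Qed.

(** * Principal values of periodic functions against a power *)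

(** The form that the principal value at [x] takes once the points [x + s] and [x - s] are paired: a
    one-sided integral over [s], truncated at both ends, with [g] the odd difference. *)
Definition pv_odd (alpha : R) (g : R -> R) (L : R) : Prop :=
  forall eta, 0 < eta -> exists e0 R0, 0 < e0 /\ 0 < R0 /\
    forall eps Rr, 0 < eps < e0 -> R0 < Rr -> eps < Rr ->
      Rabs (RInt (fun s => g s * Rpower s (- alpha)) eps Rr - L) < eta.

Lemma continuous_mult_Rpower (g : R -> R) (y s : R) : (forall s, continuous g s) -> 0 < s ->
  continuous (fun s => g s * Rpower s y) s.
Proof.
  intros Hg Hs. apply (continuous_mult g (fun s => Rpower s y)); [apply Hg|].
  eapply is_derive_continuous. apply is_derive_Reals. now apply derivable_pt_lim_power.
Qed.

Lemma ex_RInt_mult_Rpower (g : R -> R) (y a b : R) : (forall s, continuous g s) ->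
  0 < a -> 0 < b -> ex_RInt (fun s => g s * Rpower s y) a b.
Proof.
  intros Hg Ha Hb. apply (@ex_RInt_continuous R_CompleteNormedModule). intros z Hz.
  apply continuous_mult_Rpower; [easy|].
  revert Hz. unfold Rmin. destruct (Rle_dec a b); lra.
Qed.

(** The half-line is cut at the integers. By periodicity of [g], the cell [[n + 1, n + 2]] becomes
    [[0, 1]] with the weight [(s + n + 1) ^ (- alpha)], regular at 0, so the cutoff can be 0 and the
    cell contributes a nonnegative amount. The first cell loses at most a multiple of
    [eps ^ (2 - alpha)], which vanishes in the limit because [alpha < 2]. *)
Lemma pv_odd_nonneg (alpha C L : R) (g phi : R -> R) :
  0 < alpha < 2 ->
  (forall s, is_derive phi s (g s)) -> (forall s, continuous g s) ->
  (forall s, g (s + 1) = g s) ->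
  phi 0 = 0 -> (forall s, phi (s + 1) = phi s) -> (forall s, phi (- s) = phi s) ->
  (forall r, 0 <= r <= 1/2 -> 0 <= RInt phi 0 r) ->
  (forall s, 0 <= s <= 1 -> Rabs (g s) <= C * s) ->
  pv_odd alpha g L -> 0 <= L.
Proof.
  intros Ha dphi cg gP phi0 phiP phiE HPhi Hg HL.
  set (G := fun s => g s * Rpower s (- alpha)).
  set (W a := fun s => Rpower (s + a) (- alpha)).
  set (W1 a := fun s => - alpha * Rpower (s + a) (- alpha - 1)).
  set (W2 a := fun s => - alpha * ((- alpha - 1) * Rpower (s + a) (- alpha - 1 - 1))).
  (* One statement for both kinds of cell: [a = 0] with [eps > 0] near the singularity, and
     [a = n + 1] with [eps = 0] for the tail. *)
  assert (weight : forall a eps, 0 <= eps <= 1/2 -> 0 < eps + a ->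
    - (C * eps ^ 2 * Rabs (W a eps) + C * eps ^ 3 * Rabs (W1 a eps) + C * eps ^ 4 * W2 a (1/2))
    <= RInt (fun s => g s * W a s) eps 1).
  { intros a eps He Hea.
    assert (pos : forall s, eps <= s <= 1 -> 0 < s + a) by (intros; lra).
    apply (weighted_integral_lower_bound g phi (W a) (W1 a) (W2 a)); auto.
    - intros s Hs. apply is_derive_Rpower_shift. auto.
    - intros s Hs. apply (is_derive_scal (fun s => Rpower (s + a) (- alpha - 1))).
      apply is_derive_Rpower_shift. auto.
    - intros s Hs. apply (is_derive_continuous _ _
        (- alpha * ((- alpha - 1) * ((- alpha - 1 - 1) * Rpower (s + a) (- alpha - 1 - 1 - 1))))).
      apply (is_derive_scal (fun s => (- alpha - 1) * Rpower (s + a) (- alpha - 1 - 1))).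
      apply (is_derive_scal (fun s => Rpower (s + a) (- alpha - 1 - 1))).
      apply is_derive_Rpower_shift. auto.
    - unfold W1. generalize (exp_pos ((- alpha - 1) * ln (1 + a))). fold (Rpower (1 + a) (- alpha - 1)). nra.
    - intros s Hs. unfold W2. generalize (exp_pos ((- alpha - 1 - 1) * ln (s + a))).
      fold (Rpower (s + a) (- alpha - 1 - 1)).
      set (P := Rpower _ _). intros HP.
      replace (- alpha * ((- alpha - 1) * P)) with (alpha * (alpha + 1) * P) by ring.
      apply Rmult_le_pos; [nra|lra].
    - intros s s' H1 H2 H3. unfold W2.
      assert (HP := Rpower_antitone (alpha + 2) (s + a) (s' + a) ltac:(lra) ltac:(lra)).
      replace (- alpha - 1 - 1) with (- (alpha + 2)) by ring.
      replace (- alpha * ((- alpha - 1) * Rpower (s + a) (- (alpha + 2))))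
        with (alpha * (alpha + 1) * Rpower (s + a) (- (alpha + 2))) by ring.
      replace (- alpha * ((- alpha - 1) * Rpower (s' + a) (- (alpha + 2))))
        with (alpha * (alpha + 1) * Rpower (s' + a) (- (alpha + 2))) by ring.
      apply Rmult_le_compat_l; [nra|easy]. }
  assert (gN : forall n s, g (s + INR n) = g s).
  { induction n as [|n IH]; intros s.
    - simpl. f_equal; ring.
    - rewrite S_INR. rewrite <- (IH s), <- (gP (s + INR n)). f_equal; ring. }
  assert (tail : forall n, 0 <= RInt G (INR n + 1) (INR n + 1 + 1)).
  { intros n. assert (0 <= INR n) by apply pos_INR.
    replace (RInt G (INR n + 1) (INR n + 1 + 1))
      with (RInt (fun s => g s * W (INR n + 1) s) 0 1).
    - apply Rle_trans with (2 := weight (INR n + 1) 0 ltac:(lra) ltac:(lra)).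
      apply Req_le. ring.
    - replace (RInt G (INR n + 1) (INR n + 1 + 1))
        with (RInt G (0 + (INR n + 1)) (1 + (INR n + 1))) by (f_equal; ring).
      rewrite <- RInt_shift by (apply ex_RInt_mult_Rpower; [easy|lra|lra]).
      apply RInt_ext. intros s _. unfold G, W.
      rewrite <- S_INR, gN. reflexivity. }
  assert (chain : forall n eps, 0 < eps <= 1/2 -> RInt G eps 1 <= RInt G eps (INR n + 1)).
  { intros n eps He. induction n as [|n IH].
    - simpl. replace (0 + 1) with 1 by ring. lra.
    - assert (0 <= INR n) by apply pos_INR.
      rewrite S_INR, (RInt_split G eps (INR n + 1) (INR n + 1 + 1))
        by (apply ex_RInt_mult_Rpower; [easy|lra|lra]).
      generalize (tail n). lra. }
  assert (C0 : 0 <= C).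
  { generalize (Hg 1 ltac:(lra)) (Rabs_pos (g 1)). lra. }
  (* The three summands come from the three error terms at [a = 0]: the first two are exact
     multiples of [eps ^ (2 - alpha)], and the third uses [eps ^ 4 <= eps ^ (2 - alpha)] for
     [eps <= 1/2]. *)
  set (K := C * (1 + alpha + W2 0 (1/2))).
  assert (HW2 : 0 <= W2 0 (1/2)).
  { unfold W2. generalize (exp_pos ((- alpha - 1 - 1) * ln (1/2 + 0))).
    fold (Rpower (1/2 + 0) (- alpha - 1 - 1)). set (P := Rpower _ _). intros HP.
    replace (- alpha * ((- alpha - 1) * P)) with (alpha * (alpha + 1) * P) by ring.
    apply Rmult_le_pos; [nra|lra]. }
  assert (K0 : 0 <= K) by (apply Rmult_le_pos; lra).
  assert (lower : forall n eps, 0 < eps <= 1/2 ->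
    - (K * Rpower eps (2 - alpha)) <= RInt G eps (INR n + 1)).
  { intros n eps He. apply Rle_trans with (2 := chain n eps He).
    replace (RInt G eps 1) with (RInt (fun s => g s * W 0 s) eps 1).
    2:{ apply RInt_ext. intros s _. unfold W, G. now rewrite Rplus_0_r. }
    apply Rle_trans with (2 := weight 0 eps ltac:(lra) ltac:(lra)).
    apply Ropp_le_contravar.
    assert (E1 : eps ^ 2 * Rabs (W 0 eps) = Rpower eps (2 - alpha)).
    { unfold W. rewrite Rplus_0_r, Rabs_pos_eq by (left; apply exp_pos).
      apply (Rpower_pow_opp eps 2). lra. }
    assert (E2 : eps ^ 3 * Rabs (W1 0 eps) = alpha * Rpower eps (2 - alpha)).
    { unfold W1. rewrite Rplus_0_r, Rabs_mult, Rabs_Ropp, (Rabs_pos_eq alpha), Rabs_pos_eq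
        by (try (left; apply exp_pos); lra).
      replace (2 - alpha) with (INR 3 - (alpha + 1)) by (simpl; ring).
      rewrite <- Rpower_pow_opp by lra. replace (- (alpha + 1)) with (- alpha - 1) by ring. ring. }
    assert (E3 : eps ^ 4 <= Rpower eps (2 - alpha)).
    { replace (2 - alpha) with (INR 2 - alpha) by (simpl; ring).
      rewrite <- Rpower_pow_opp by lra.
      assert (1 <= Rpower eps (- alpha)).
      { replace 1 with (Rpower 1 (- alpha)); [apply Rpower_antitone; lra|].
        unfold Rpower. rewrite ln_1, Rmult_0_r. apply exp_0. }
      assert (0 <= eps ^ 2 <= 1) by (simpl; nra).
      replace (eps ^ 4) with (eps ^ 2 * eps ^ 2) by ring. nra. }
    assert (P := exp_pos ((2 - alpha) * ln eps)). fold (Rpower eps (2 - alpha)) in P.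
    unfold K. rewrite !Rmult_assoc. rewrite E1, E2.
    assert (eps ^ 4 * W2 0 (1/2) <= Rpower eps (2 - alpha) * W2 0 (1/2))
      by (apply Rmult_le_compat_r; easy).
    rewrite <- !Rmult_plus_distr_l. apply Rmult_le_compat_l; [easy|]. lra. }
  destruct (Rle_lt_dec 0 L) as [|Lneg]; [easy|exfalso].
  destruct (HL (- L / 2) ltac:(lra)) as (e0 & R0 & He0 & HR0 & H).
  (* Half of [- L] is left to the convergence error and half to the loss near 0. Dividing by [K + 1]
     covers [K = 0]. *)
  destruct (Rpower_small (2 - alpha) (- L / 2 / (K + 1)) ltac:(lra)) as (e1 & He1 & H1).
  { apply Rdiv_lt_0_compat; lra. }
  set (eps := Rmin (1/2) (Rmin (e0 / 2) (e1 / 2))).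
  assert (Heps : 0 < eps <= 1/2 /\ eps <= e0 / 2 /\ eps <= e1 / 2).
  { assert (0 < eps) by (unfold eps; repeat apply Rmin_glb_lt; lra).
    generalize (Rmin_l (1/2) (Rmin (e0 / 2) (e1 / 2))) (Rmin_r (1/2) (Rmin (e0 / 2) (e1 / 2)))
      (Rmin_l (e0 / 2) (e1 / 2)) (Rmin_r (e0 / 2) (e1 / 2)).
    fold eps. lra. }
  destruct (INR_unbounded R0) as [n Hn].
  specialize (H eps (INR n + 1) ltac:(lra) ltac:(lra)).
  assert (0 <= INR n) by apply pos_INR. specialize (H ltac:(lra)).
  specialize (lower n eps ltac:(lra)). fold G in H.
  specialize (H1 eps ltac:(lra)).
  assert (K * Rpower eps (2 - alpha) < - L / 2).
  { assert (P := exp_pos ((2 - alpha) * ln eps)). fold (Rpower eps (2 - alpha)) in P.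
    apply Rmult_lt_compat_l with (r := K + 1) in H1; [|lra].
    replace ((K + 1) * (- L / 2 / (K + 1))) with (- L / 2) in H1 by (field; lra). nra. }
  apply Rabs_def2 in H. lra.
Qed.

Lemma pv_odd_lin (alpha a b L M : R) (g h : R -> R) :
  (forall s, continuous g s) -> (forall s, continuous h s) ->
  pv_odd alpha g L -> pv_odd alpha h M ->
  pv_odd alpha (fun s => a * g s + b * h s) (a * L + b * M).
Proof.
  intros cg ch HL HM eta Heta.
  set (k := Rabs a + Rabs b + 1).
  assert (Hk : 0 < k) by (unfold k; generalize (Rabs_pos a) (Rabs_pos b); lra).
  destruct (HL (eta / k)) as (e1 & R1 & He1 & HR1 & H1); [now apply Rdiv_lt_0_compat|].
  destruct (HM (eta / k)) as (e2 & R2 & He2 & HR2 & H2); [now apply Rdiv_lt_0_compat|].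
  exists (Rmin e1 e2), (Rmax R1 R2).
  split; [now apply Rmin_glb_lt|]. split; [apply Rlt_le_trans with (2 := Rmax_l _ _); lra|].
  intros eps Rr Heps HRr Hlt.
  generalize (Rmin_l e1 e2) (Rmin_r e1 e2) (Rmax_l R1 R2) (Rmax_r R1 R2). intros.
  specialize (H1 eps Rr ltac:(lra) ltac:(lra) Hlt). specialize (H2 eps Rr ltac:(lra) ltac:(lra) Hlt).
  set (I := RInt _ _ _) in H1. set (J := RInt _ _ _) in H2.
  assert (E : RInt (fun s => (a * g s + b * h s) * Rpower s (- alpha)) eps Rr = a * I + b * J).
  { assert (e1' := ex_RInt_mult_Rpower g (- alpha) eps Rr cg ltac:(lra) ltac:(lra)).
    assert (e2' := ex_RInt_mult_Rpower h (- alpha) eps Rr ch ltac:(lra) ltac:(lra)).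
    apply is_RInt_unique.
    apply (is_RInt_ext (fun s => plus (scal a (g s * Rpower s (- alpha)))
             (scal b (h s * Rpower s (- alpha))))).
    { intros s _. unfold plus, scal; simpl; unfold mult; simpl. ring. }
    apply (@is_RInt_plus R_NormedModule); apply (@is_RInt_scal R_NormedModule);
      apply (@RInt_correct R_CompleteNormedModule); easy. }
  rewrite E. replace (a * I + b * J - (a * L + b * M)) with (a * (I - L) + b * (J - M)) by ring.
  apply Rle_lt_trans with (1 := Rabs_triang _ _). rewrite !Rabs_mult.
  assert (Rabs a * Rabs (I - L) <= Rabs a * (eta / k)) by (apply Rmult_le_compat_l; [apply Rabs_pos|lra]).
  assert (Rabs b * Rabs (J - M) <= Rabs b * (eta / k)) by (apply Rmult_le_compat_l; [apply Rabs_pos|lra]).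
  assert (0 < eta / k) by (now apply Rdiv_lt_0_compat).
  assert (eta = k * (eta / k)) by (field; lra).
  unfold k in *. lra.
Qed.

(** * The velocity as a principal value of odd differences *)

Lemma continuous_affine (f : R -> R) (a b s : R) : (forall y, continuous f y) ->
  continuous (fun s => f (a + b * s)) s.
Proof.
  intros Hf. apply (continuous_comp (fun s => a + b * s) f); [|apply Hf].
  apply (continuous_plus (fun _ => a) (fun s => b * s)); [apply continuous_const|].
  apply (continuous_mult (fun _ => b) (fun s => s)); [apply continuous_const|apply continuous_id].
Qed.

Lemma continuous_odd_difference (f : R -> R) (x s : R) : (forall y, continuous f y) ->
  continuous (fun s => f (x + s) - f (x - s)) s.
Proof.
  intros Hf.
  apply (continuous_ext (fun s => minus (f (x + 1 * s)) (f (x + -1 * s)))).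
  { intros t. replace (x + 1 * t) with (x + t) by ring.
    replace (x + -1 * t) with (x - t) by ring. reflexivity. }
  apply (continuous_minus (fun s => f (x + 1 * s)) (fun s => f (x + -1 * s)));
    now apply continuous_affine.
Qed.

(** Substituting [y = x - s] on the left and [y = x + s] on the right, the sign in the kernel is 1
    and -1 respectively. The values [f x] cancel and the truncated integrals become minus those of
    the odd difference, which is the origin of the sign in [v = - (c * L)]. *)
Lemma velocity_pv_odd (alpha c : R) (f : R -> R) (x v : R) :
  (forall y, continuous f y) -> velocity_is alpha c f x v ->
  exists L, v = - (c * L) /\ pv_odd alpha (fun s => f (x + s) - f (x - s)) L.
Proof.
  intros cf (L & [Hex Hlim] & Hv). exists (- L). split; [rewrite Hv; ring|].
  intros eta Heta. destruct (Hlim eta Heta) as (e0 & R0 & He0 & HR0 & H).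
  exists e0, R0. split; [easy|]. split; [easy|].
  intros eps Rr Heps HRr Hlt.
  destruct (Hex eps Rr ltac:(lra)) as [v' Hv'].
  specialize (H eps Rr v' Heps HRr Hv').
  destruct Hv' as (v1 & v2 & [pr1 E1] & [pr2 E2] & E).
  rewrite <- RInt_Reals in E1, E2.
  assert (ex1 := ex_RInt_Reals_1 _ _ _ pr1). assert (ex2 := ex_RInt_Reals_1 _ _ _ pr2).
  set (ker := vel_kernel alpha f x) in *.
  assert (F1 : v1 = RInt (fun s => (f (x - s) - f x) * Rpower s (- alpha)) eps Rr).
  { rewrite <- E1, <- RInt_reflect by exact ex1. apply RInt_ext_le; [lra|]. intros s Hs.
    unfold ker, vel_kernel, Rsgn. replace (x - (x - s)) with s by ring.
    rewrite Rpower_Ropp, Rabs_pos_eq by lra. destruct (Rlt_dec 0 s); [|lra].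
    field. apply Rgt_not_eq, exp_pos. }
  assert (F2 : v2 = RInt (fun s => - (f (x + s) - f x) * Rpower s (- alpha)) eps Rr).
  { rewrite <- E2. rewrite (Rplus_comm x eps), (Rplus_comm x Rr) in *.
    rewrite <- RInt_shift by exact ex2. apply RInt_ext_le; [lra|]. intros s Hs.
    unfold ker, vel_kernel, Rsgn. replace (x - (s + x)) with (- s) by ring.
    rewrite Rpower_Ropp, Rabs_Ropp, Rabs_pos_eq by lra.
    destruct (Rlt_dec 0 (- s)); [lra|]. destruct (Rlt_dec (- s) 0); [|lra].
    rewrite (Rplus_comm s x). field. apply Rgt_not_eq, exp_pos. }
  assert (E3 : RInt (fun s => (f (x + s) - f (x - s)) * Rpower s (- alpha)) eps Rr = - v').
  { apply is_RInt_unique.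
    replace (- v') with (opp (plus v1 v2)) by (rewrite E; reflexivity).
    apply (is_RInt_ext (fun s => opp (plus ((f (x - s) - f x) * Rpower s (- alpha))
             (- (f (x + s) - f x) * Rpower s (- alpha))))).
    { intros s _. unfold plus, opp; simpl. ring. }
    apply (@is_RInt_opp R_NormedModule). rewrite F1, F2.
    apply (@is_RInt_plus R_NormedModule); apply (@RInt_correct R_CompleteNormedModule).
    - apply (ex_RInt_mult_Rpower (fun s => f (x - s) - f x)); [|lra|lra]. intros s.
      apply (continuous_minus (fun s => f (x - s)) (fun _ => f x)); [|apply continuous_const].
      apply (continuous_ext (fun s => f (x + -1 * s))); [intros t; apply f_equal; ring|].
      now apply continuous_affine.
    - apply (ex_RInt_mult_Rpower (fun s => - (f (x + s) - f x))); [|lra|lra]. intros s.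
      apply (continuous_opp (fun s => f (x + s) - f x)).
      apply (continuous_minus (fun s => f (x + s)) (fun _ => f x)); [|apply continuous_const].
      apply (continuous_ext (fun s => f (x + 1 * s))); [intros t; apply f_equal; ring|].
      now apply continuous_affine. }
  rewrite E3. replace (- v' - - L) with (- (v' - L)) by ring. now rewrite Rabs_Ropp.
Qed.

Lemma bounded_on_segment (f : R -> R) (a b : R) : a <= b ->
  (forall y, a <= y <= b -> continuous f y) ->
  exists M, 0 <= M /\ forall y, a <= y <= b -> Rabs (f y) <= M.
Proof.
  intros Hab Hf.
  destruct (continuity_ab_maj (fun y => Rabs (f y)) a b Hab) as [m [Hm _]].
  - intros y Hy. apply continuity_pt_filterlim.
    apply (continuous_comp f Rabs); [now apply Hf|apply (continuous_abs (f y))].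
  - exists (Rabs (f m)). split; [apply Rabs_pos|exact Hm].
Qed.

(** This linear vanishing at [s = 0] is what tames the singularity [s ^ (- alpha)] for [alpha < 2];
    it rests on the continuity of [df]. *)
Lemma odd_difference_linear_bound (f df : R -> R) (a : R) :
  (forall y, is_derive f y (df y)) -> (forall y, continuous df y) ->
  exists C, forall s, 0 <= s <= 1 -> Rabs (f (a + s) - f (a - s)) <= C * s.
Proof.
  intros Hf Hdf.
  destruct (bounded_on_segment df (a - 1) (a + 1)) as (M & M0 & HM); [lra|auto|].
  exists (2 * M). intros s Hs.
  destruct (MVT_gen f (a - s) (a + s) df) as [y [Hy Heq]].
  - intros; apply Hf.
  - intros y _. apply continuity_pt_filterlim. exact (is_derive_continuous _ _ _ (Hf y)).
  - rewrite Rmin_left, Rmax_right in Hy by lra.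
    rewrite Heq, Rabs_mult, (Rabs_pos_eq (_ - _)) by lra.
    generalize (HM y ltac:(lra)) (Rabs_pos (df y)). intros. nra.
Qed.

Lemma is_derive_affine (F f : R -> R) (a b s : R) : (forall y, is_derive F y (f y)) ->
  is_derive (fun s => F (a + b * s)) s (b * f (a + b * s)).
Proof.
  intros HF.
  apply (is_derive_comp F (fun s => a + b * s)); [apply HF|].
  auto_derive; [easy|ring].
Qed.

Lemma is_derive_second_difference (F f : R -> R) (a s : R) : (forall y, is_derive F y (f y)) ->
  is_derive (fun s => F (a + s) + F (a - s) - 2 * F a) s (f (a + s) - f (a - s)).
Proof.
  intros HF.
  apply (is_derive_ext (fun s => minus (plus (F (a + 1 * s)) (F (a + -1 * s))) (2 * F a))).
  { intros t. replace (a + 1 * t) with (a + t) by ring.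
    replace (a + -1 * t) with (a - t) by ring. reflexivity. }
  replace (f (a + s) - f (a - s)) with
    (minus (plus (1 * f (a + 1 * s)) (-1 * f (a + -1 * s))) 0).
  - apply (@is_derive_minus R_AbsRing R_NormedModule).
    + apply (@is_derive_plus R_AbsRing R_NormedModule); now apply is_derive_affine.
    + apply (is_derive_const (K := R_AbsRing) (V := R_NormedModule)).
  - unfold minus, plus, opp; simpl.
    replace (a + 1 * s) with (a + s) by ring. replace (a + -1 * s) with (a - s) by ring. ring.
Qed.

(** As a function of [s] it is the primitive, vanishing at 0, of the odd difference of [V'] at
    [a]. *)
Definition second_difference (V : R -> R) (a s : R) : R := V (a + s) + V (a - s) - 2 * V a.

(** The combination of second differences serves as [phi] in [pv_odd_nonneg]: it is even in [s], and
    1-periodic because the increments [M] and [- M] cancel. Only its integrals over [[0, r]] need a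
    sign, which is what the folding onto [[0, 1/2]] provides. Three points cover every combination
    used below. *)
Lemma velocity_combination (alpha c M p1 p2 p3 a1 a2 a3 : R) (f df V u : R -> R) :
  0 < alpha < 2 -> 0 < c ->
  periodic1 f -> (forall y, is_derive f y (df y)) -> (forall y, continuous df y) ->
  (forall y, is_derive V y (f y)) -> (forall y, V (y + 1) = V y + M) ->
  (forall x, velocity_is alpha c f x (u x)) ->
  (forall r, 0 <= r <= 1/2 -> 0 <= RInt (fun s => p1 * second_difference V a1 s
     + p2 * second_difference V a2 s + p3 * second_difference V a3 s) 0 r) ->
  p1 * u a1 + p2 * u a2 + p3 * u a3 <= 0.
Proof.
  intros Ha Hc fP Hf Hdf HV VP Hu HD.
  assert (cf : forall y, continuous f y) by (intros y; exact (is_derive_continuous _ _ _ (Hf y))).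
  destruct (velocity_pv_odd alpha c f a1 _ cf (Hu a1)) as (L1 & -> & P1).
  destruct (velocity_pv_odd alpha c f a2 _ cf (Hu a2)) as (L2 & -> & P2).
  destruct (velocity_pv_odd alpha c f a3 _ cf (Hu a3)) as (L3 & -> & P3).
  destruct (odd_difference_linear_bound f df a1 Hf Hdf) as [C1 B1].
  destruct (odd_difference_linear_bound f df a2 Hf Hdf) as [C2 B2].
  destruct (odd_difference_linear_bound f df a3 Hf Hdf) as [C3 B3].
  assert (cd : forall a s, continuous (fun s => f (a + s) - f (a - s)) s)
    by (intros; now apply continuous_odd_difference).
  (* The leading factor 1 gives [g] the shape of two nested uses of [pv_odd_lin]. *)
  set (g := fun s => 1 * (p1 * (f (a1 + s) - f (a1 - s)) + p2 * (f (a2 + s) - f (a2 - s)))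
     + p3 * (f (a3 + s) - f (a3 - s))).
  assert (lin : forall a b (h k : R -> R) s, continuous h s -> continuous k s ->
     continuous (fun s => a * h s + b * k s) s).
  { intros a b h k s H1 H2. apply (continuous_plus (fun s => a * h s) (fun s => b * k s));
      apply (continuous_scal_r (K := R_AbsRing) (V := R_NormedModule)); easy. }
  assert (cg : forall s, continuous g s).
  { intros s. apply lin; [|apply cd]. apply lin; apply cd. }
  assert (P : pv_odd alpha g (1 * (p1 * L1 + p2 * L2) + p3 * L3)).
  { apply pv_odd_lin; [|apply cd| |easy]; [intros s; apply lin; apply cd|].
    apply pv_odd_lin; try easy; apply cd. }
  assert (0 <= 1 * (p1 * L1 + p2 * L2) + p3 * L3); [|nra].
  set (phi := fun s => p1 * second_difference V a1 s
     + p2 * second_difference V a2 s + p3 * second_difference V a3 s).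
  apply (pv_odd_nonneg alpha (Rabs p1 * C1 + Rabs p2 * C2 + Rabs p3 * C3) _ g phi); auto.
  - intros s.
    assert (Q : forall a, is_derive (second_difference V a) s (f (a + s) - f (a - s)))
      by (intros a; now apply is_derive_second_difference).
    apply (is_derive_ext (fun s => plus (plus (scal p1 (second_difference V a1 s))
       (scal p2 (second_difference V a2 s))) (scal p3 (second_difference V a3 s)))); [easy|].
    replace (g s) with (plus (plus (scal p1 (f (a1 + s) - f (a1 - s)))
       (scal p2 (f (a2 + s) - f (a2 - s)))) (scal p3 (f (a3 + s) - f (a3 - s))))
      by (unfold g, plus, scal; simpl; unfold mult; simpl; ring).
    repeat apply (@is_derive_plus R_AbsRing R_NormedModule);
      apply (@is_derive_scal R_AbsRing R_NormedModule) || apply is_derive_scal; apply Q.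
  - intros s. unfold g.
    assert (Q : forall a, f (a + (s + 1)) = f (a + s) /\ f (a - (s + 1)) = f (a - s)).
    { intros a. split; [rewrite <- (fP (a + s))|rewrite <- (fP (a - (s + 1)))]; f_equal; ring. }
    destruct (Q a1) as [-> ->], (Q a2) as [-> ->], (Q a3) as [-> ->]. reflexivity.
  - unfold phi, second_difference. rewrite !Rplus_0_r, !Rminus_0_r. ring.
  - intros s. unfold phi, second_difference.
    assert (Q : forall a, V (a + (s + 1)) = V (a + s) + M /\ V (a - (s + 1)) = V (a - s) - M).
    { intros a. split; [rewrite <- (VP (a + s)); f_equal; ring|].
      replace (V (a - s)) with (V (a - (s + 1) + 1)) by (f_equal; ring). rewrite VP. ring. }
    destruct (Q a1) as [-> ->], (Q a2) as [-> ->], (Q a3) as [-> ->]. ring.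
  - intros s. unfold phi, second_difference.
    assert (Q : forall a, a - - s = a + s) by (intros; ring). rewrite !Q.
    replace (a1 + - s) with (a1 - s) by ring. replace (a2 + - s) with (a2 - s) by ring.
    replace (a3 + - s) with (a3 - s) by ring. ring.
  - intros s Hs. unfold g.
    apply Rle_trans with (1 := Rabs_triang _ _). rewrite Rmult_1_l.
    rewrite !Rmult_plus_distr_r. rewrite !Rmult_assoc.
    apply Rplus_le_compat.
    + apply Rle_trans with (1 := Rabs_triang _ _).
      apply Rplus_le_compat; rewrite Rabs_mult; apply Rmult_le_compat_l;
        auto using Rabs_pos.
    + rewrite Rabs_mult; apply Rmult_le_compat_l; auto using Rabs_pos.
Qed.

(** * Minimum principle *)

(** The minimal value over [P] is a continuous function of [x], since the modulus of continuity of
    [F] in [x] is uniform over [P]; it therefore attains its minimum on [[a, b]]. With [A]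
    arbitrary, the lemma can be iterated, one real variable at a time. *)
Lemma iterated_minimum (A : Type) (P : A -> Prop) (F : R -> A -> R) (a b : R) : a <= b ->
  (forall x, a <= x <= b -> exists p, P p /\ forall q, P q -> F x p <= F x q) ->
  (forall x, a <= x <= b -> forall eps, 0 < eps -> exists d, 0 < d /\
     forall y, a <= y <= b -> Rabs (y - x) < d -> forall q, P q -> Rabs (F y q - F x q) <= eps) ->
  exists x p, a <= x <= b /\ P p /\ forall y q, a <= y <= b -> P q -> F x p <= F y q.
Proof.
  intros Hab Hmin Hcont.
  (* Clamping to [[a, b]] makes the minimiser a total function and gives two-sided continuity at the
     end points. *)
  set (cl y := Rmax a (Rmin b y)).
  assert (Hcl : forall y, a <= cl y <= b).
  { intros y. unfold cl, Rmax, Rmin. repeat destruct Rle_dec; lra. }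
  assert (clid : forall y, a <= y <= b -> cl y = y).
  { intros y Hy. unfold cl. rewrite Rmin_right, Rmax_right; lra. }
  assert (cll : forall y z, Rabs (cl y - cl z) <= Rabs (y - z)).
  { intros y z. unfold cl, Rmax, Rmin. repeat destruct Rle_dec; split_Rabs; lra. }
  pose (pm y := proj1_sig (constructive_indefinite_description _ (Hmin (cl y) (Hcl y)))).
  assert (Hpm : forall y, P (pm y) /\ forall q, P q -> F (cl y) (pm y) <= F (cl y) q).
  { intros y. unfold pm. destruct constructive_indefinite_description as [p Hp]. exact Hp. }
  clearbody pm.
  destruct (continuity_ab_min (fun y => F (cl y) (pm y)) a b Hab) as [x [Hx Hxab]].
  - intros c _. apply continuity_pt_filterlim.
    apply (filterlim_locally (F := locally c)). intros eps.
    destruct (Hcont (cl c) (Hcl c) (eps / 2)) as (d & Hd & H).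
    { generalize (cond_pos eps). lra. }
    exists (mkposreal d Hd). intros y Hy.
    change (Rabs (y - c) < d) in Hy.
    change (Rabs (F (cl y) (pm y) - F (cl c) (pm c)) < eps).
    assert (Hyc := cll y c).
    assert (H1 := H (cl y) (Hcl y) ltac:(lra)).
    destruct (Hpm y) as [Py My], (Hpm c) as [Pc Mc].
    generalize (H1 _ Py) (H1 _ Pc) (My _ Pc) (Mc _ Py) (cond_pos eps). intros.
    split_Rabs; lra.
  - exists (cl x), (pm x). split; [easy|]. split; [apply Hpm|].
    intros y q Hy Hq. apply Rle_trans with (1 := Hx y Hy).
    rewrite <- (clid y Hy) at 3. now apply Hpm.
Qed.

Lemma exists_lower_left_of_positive_derivative (h : R -> R) (t l : R) :
  0 < t -> 0 < l -> is_derive h t l -> exists s, 0 <= s < t /\ h s < h t.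
Proof.
  intros Ht Hl H. apply is_derive_Reals in H.
  destruct (H (l / 2) ltac:(lra)) as [d Hd].
  set (k := Rmin (d / 2) (t / 2)).
  assert (Hk : 0 < k) by (apply Rmin_glb_lt; generalize (cond_pos d); lra).
  assert (Hk1 : k <= d / 2) by apply Rmin_l. assert (Hk2 : k <= t / 2) by apply Rmin_r.
  exists (t + - k). split; [lra|].
  specialize (Hd (- k) ltac:(lra)).
  rewrite Rabs_Ropp, Rabs_pos_eq in Hd by lra. specialize (Hd ltac:(lra)).
  apply Rabs_def2 in Hd. destruct Hd as [_ Hd].
  set (q := (h (t + - k) - h t) / - k) in Hd.
  assert (h (t + - k) - h t = - (q * k)) by (unfold q; field; lra).
  assert (0 < q * k) by (apply Rmult_lt_0_compat; lra). lra.
Qed.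

(** If [F] were negative somewhere, [F + e * t] with a small slope [e] would have a negative minimum
    over the compact box. It is not at time 0, and at a positive time [F] would be negative and
    minimal in [(x, z)], so [F + e * t] would have a positive time derivative and a smaller value
    just before. *)
Lemma minimum_principle (X : R) (F : R -> R -> R -> R) : 0 <= X ->
  (forall t, 0 <= t -> exists M, 0 <= M /\ forall x x' z z',
     0 <= x <= X -> 0 <= x' <= X -> 0 <= z <= 1 -> 0 <= z' <= 1 ->
     Rabs (F x z t - F x' z' t) <= M * (Rabs (x - x') + Rabs (z - z'))) ->
  (forall t, 0 <= t -> forall eps, 0 < eps -> exists d, 0 < d /\
     forall s, 0 <= s -> Rabs (s - t) < d -> forall x z, 0 <= x <= X -> 0 <= z <= 1 ->
     Rabs (F x z s - F x z t) <= eps) ->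
  (forall x z, 0 <= x <= X -> 0 <= z <= 1 -> 0 <= F x z 0) ->
  (forall x z t, 0 <= x <= X -> 0 <= z <= 1 -> 0 < t -> F x z t < 0 ->
     (forall x' z', 0 <= x' <= X -> 0 <= z' <= 1 -> F x z t <= F x' z' t) ->
     exists d, 0 <= d /\ is_derive (F x z) t d) ->
  forall x z t, 0 <= x <= X -> 0 <= z <= 1 -> 0 <= t -> 0 <= F x z t.
Proof.
  intros HX Hlip Htime H0 Hcrit x1 z1 T Hx1 Hz1 HT.
  destruct (Rle_lt_dec 0 (F x1 z1 T)) as [|Hneg]; [easy|exfalso].
  assert (Tpos : 0 < T).
  { destruct (Rle_lt_or_eq_dec _ _ HT) as [|<-]; [easy|].
    generalize (H0 x1 z1 Hx1 Hz1). lra. }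
  (* This slope leaves half of the negative value: [F x1 z1 T + e * T] equals [F x1 z1 T / 2]. *)
  set (e := - F x1 z1 T / (2 * T)).
  assert (He : 0 < e) by (apply Rdiv_lt_0_compat; lra).
  assert (HeT : e * T = - F x1 z1 T / 2) by (unfold e; field; lra).
  pose (box (p : R * R) := 0 <= fst p <= X /\ 0 <= snd p <= 1).
  pose (G (t : R) (p : R * R) := F (fst p) (snd p) t + e * t).
  (* Minimisation in [t], then in [x], then in [z]; for the last variable the remaining parameter is
     a dummy of type [unit]. *)
  destruct (iterated_minimum (R * R) box G 0 T HT) as (t0 & [x0 z0] & Ht0 & [Hx0 Hz0] & Hmin).
  - intros t Ht. destruct (Hlip t (proj1 Ht)) as (M & HM & HL).
    assert (absorb : forall eps r, 0 < eps -> Rabs r < eps / (M + 1) -> M * Rabs r <= eps).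
    { intros eps r Heps Hr. apply Rmult_lt_compat_l with (r := M + 1) in Hr; [|lra].
      replace ((M + 1) * (eps / (M + 1))) with eps in Hr by (field; lra).
      generalize (Rabs_pos r). lra. }
    destruct (iterated_minimum R (fun z => 0 <= z <= 1) (fun x z => F x z t) 0 X HX)
      as (x & z & Hx & Hz & H).
    + intros x Hx.
      destruct (iterated_minimum unit (fun _ => True) (fun z _ => F x z t) 0 1 Rle_0_1)
        as (z & [] & Hz & _ & H).
      * intros z _. exists tt. split; [easy|]. intros [] _. apply Rle_refl.
      * intros z Hz eps Heps. exists (eps / (M + 1)). split; [apply Rdiv_lt_0_compat; lra|].
        intros y Hy Hyz _ _. apply Rle_trans with (1 := HL x x y z Hx Hx Hy Hz).
        rewrite (Rminus_diag_eq x x), Rabs_R0, Rplus_0_l by easy. now apply absorb.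
      * exists z. split; [easy|]. intros z' Hz'. now apply (H z' tt).
    + intros x Hx eps Heps. exists (eps / (M + 1)). split; [apply Rdiv_lt_0_compat; lra|].
      intros y Hy Hyx z Hz. apply Rle_trans with (1 := HL y x z z Hy Hx Hz Hz).
      rewrite (Rminus_diag_eq z z), Rabs_R0, Rplus_0_r by easy. now apply absorb.
    + exists (x, z). split; [split; easy|]. intros [x' z'] [Hx' Hz']. unfold G.
      simpl in *. generalize (H x' z' Hx' Hz'). lra.
  - intros t Ht eps Heps. destruct (Htime t (proj1 Ht) (eps / 2) ltac:(lra)) as (d & Hd & H).
    exists (Rmin d (eps / (2 * e))). split.
    { apply Rmin_glb_lt; [easy|apply Rdiv_lt_0_compat; lra]. }
    intros s Hs Hst [x z] [Hx Hz]. simpl in *.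
    generalize (Rmin_l d (eps / (2 * e))) (Rmin_r d (eps / (2 * e))). intros Hm1 Hm2.
    unfold G; simpl. specialize (H s (proj1 Hs) ltac:(lra) x z Hx Hz).
    replace (F x z s + e * s - (F x z t + e * t)) with ((F x z s - F x z t) + e * (s - t)) by ring.
    apply Rle_trans with (1 := Rabs_triang _ _).
    rewrite Rabs_mult, (Rabs_pos_eq e) by lra.
    assert (Hq : Rabs (s - t) < eps / (2 * e)) by lra.
    apply Rmult_lt_compat_l with (r := e) in Hq; [|lra].
    replace (e * (eps / (2 * e))) with (eps / 2) in Hq by (field; lra). lra.
  - unfold G in Hmin; simpl in Hmin, Hx0, Hz0.
    assert (Hm1 := Hmin T (x1, z1) ltac:(lra) (conj Hx1 Hz1)). simpl in Hm1.
    assert (0 <= e * t0) by (apply Rmult_le_pos; lra).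
    assert (t0pos : 0 < t0).
    { destruct (Rle_lt_or_eq_dec _ _ (proj1 Ht0)) as [|<-]; [easy|].
      generalize (H0 x0 z0 Hx0 Hz0). lra. }
    destruct (Hcrit x0 z0 t0 Hx0 Hz0 t0pos) as (d & Hd & Hder).
    + lra.
    + intros x' z' Hx' Hz'. generalize (Hmin t0 (x', z') Ht0 (conj Hx' Hz')). simpl. lra.
    (* Only earlier times are compared, so [t0 = T] is allowed. *)
    + destruct (exists_lower_left_of_positive_derivative (fun s => F x0 z0 s + e * s) t0 (d + e))
        as (s & Hs & Hlt); [easy|lra| |].
      * apply (is_derive_plus (F x0 z0) (fun s => e * s)); [easy|].
        auto_derive; [easy|ring].
      * generalize (Hmin s (x0, z0) ltac:(lra) (conj Hx0 Hz0)). simpl. lra.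
Qed.

(** * The primitive of the density and its evolution *)

Lemma cont2_at_slice (f : R -> R -> R) (x t : R) :
  cont2_at f x t -> continuous (fun y => f y t) x.
Proof.
  intros H. apply (filterlim_locally (F := locally x)). intros eps.
  destruct (H eps (cond_pos eps)) as (d & Hd & Hf).
  exists (mkposreal d Hd). intros y Hy.
  apply (Hf y t Hy). now rewrite Rminus_diag_eq, Rabs_R0.
Qed.

Lemma cont2_at_uniform_on_segment (f : R -> R -> R) (a b t eps : R) :
  (forall x, cont2_at f x t) -> 0 < eps ->
  exists d, 0 < d /\ forall s, Rabs (s - t) < d -> forall x, a <= x <= b ->
    Rabs (f x s - f x t) < eps.
Proof.
  intros Hf Heps.
  assert (Hd : forall x, exists d : posreal, forall y s, Rabs (y - x) < d -> Rabs (s - t) < d ->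
    Rabs (f y s - f x t) < eps / 2).
  { intros x. destruct (Hf x (eps / 2) ltac:(lra)) as (d & Hd & H).
    now exists (mkposreal d Hd). }
  pose (delta x := proj1_sig (constructive_indefinite_description _ (Hd x))).
  assert (Hdelta : forall x y s, Rabs (y - x) < delta x -> Rabs (s - t) < delta x ->
    Rabs (f y s - f x t) < eps / 2).
  { intros x. unfold delta. now destruct constructive_indefinite_description. }
  destruct (compactness_value_1d a b delta) as [d H].
  exists d. split; [apply cond_pos|]. intros s Hs x Hx.
  (* Compactness gives the nearby centre only under a double negation, so the inequality is decided
     first and the goal turned into a contradiction. *)
  destruct (Rlt_dec (Rabs (f x s - f x t)) eps) as [|Hn]; [easy|exfalso].
  apply (H x Hx). intros (y & Hy & Hxy & Hdy).
  assert (H1 := Hdelta y x s Hxy ltac:(lra)).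
  assert (H2 : Rabs (f x t - f y t) < eps / 2).
  { apply Hdelta; [easy|]. rewrite Rminus_diag_eq, Rabs_R0 by easy. apply cond_pos. }
  apply Hn. split_Rabs; lra.
Qed.

Lemma derive_bound_increment (F f : R -> R) (a b M : R) :
  (forall x, is_derive F x (f x)) ->
  (forall x, Rmin a b <= x <= Rmax a b -> Rabs (f x) <= M) ->
  Rabs (F b - F a) <= M * Rabs (b - a).
Proof.
  intros HF HM. destruct (MVT_gen F a b f) as [c [Hc ->]].
  - intros; apply HF.
  - intros x _. apply continuity_pt_filterlim. exact (is_derive_continuous _ _ _ (HF x)).
  - rewrite Rabs_mult. apply Rmult_le_compat_r; [apply Rabs_pos|now apply HM].
Qed.

Definition cumulative (rho : R -> R -> R) (a t : R) : R := RInt (fun y => rho y t) 0 a.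

Lemma is_derive_cumulative (rho : R -> R -> R) (t : R) : (forall x, cont2_at rho x t) ->
  forall a, is_derive (fun a => cumulative rho a t) a (rho a t).
Proof.
  intros Hc a.
  apply (is_derive_RInt (fun y => rho y t) (fun a => cumulative rho a t) 0 a).
  - apply filter_forall. intros b. apply (@RInt_correct R_CompleteNormedModule).
    apply ex_RInt_cont. intros x. now apply cont2_at_slice.
  - now apply cont2_at_slice.
Qed.

Lemma cumulative_0 (rho : R -> R -> R) (t : R) : cumulative rho 0 t = 0.
Proof. apply (RInt_point 0 (fun y => rho y t)). Qed.

Lemma cumulative_lipschitz (rho : R -> R -> R) (t : R) : (forall x, cont2_at rho x t) ->
  exists M, 0 <= M /\ forall a b, Rabs a <= 2 -> Rabs b <= 2 ->
    Rabs (cumulative rho b t - cumulative rho a t) <= M * Rabs (b - a).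
Proof.
  intros Hc. destruct (bounded_on_segment (fun y => rho y t) (-2) 2) as (M & M0 & HM); [lra| |].
  - intros y _. now apply cont2_at_slice.
  - exists M. split; [easy|]. intros a b Ha Hb.
    apply (derive_bound_increment (fun a => cumulative rho a t) (fun y => rho y t)).
    + now apply is_derive_cumulative.
    + intros x Hx. apply HM. apply Rabs_le_between in Ha, Hb.
      revert Hx. unfold Rmin, Rmax. destruct (Rle_dec a b); lra.
Qed.

(** The difference of the two primitives vanishes at 0 and has slope at most [eps / 2] on [[-2, 2]],
    the range that contains every argument used later. *)
Lemma cumulative_time_continuous (rho : R -> R -> R) (t eps : R) :
  (forall x s, 0 <= s -> cont2_at rho x s) -> 0 <= t -> 0 < eps ->
  exists d, 0 < d /\ forall s, 0 <= s -> Rabs (s - t) < d -> forall a, Rabs a <= 2 ->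
    Rabs (cumulative rho a s - cumulative rho a t) <= eps.
Proof.
  intros Hc Ht Heps.
  destruct (cont2_at_uniform_on_segment rho (-2) 2 t (eps / 2)) as (d & Hd & H); [auto|lra|].
  exists d. split; [easy|]. intros s Hs Hst a Ha.
  assert (HD := derive_bound_increment (fun a => cumulative rho a s - cumulative rho a t)
    (fun y => rho y s - rho y t) 0 a (eps / 2)).
  cbv beta in HD. rewrite !cumulative_0 in HD.
  replace (cumulative rho a s - cumulative rho a t - (0 - 0))
    with (cumulative rho a s - cumulative rho a t) in HD by ring.
  apply Rle_trans with (eps / 2 * Rabs (a - 0)).
  - apply HD.
    + intros x. apply (is_derive_minus (fun a => cumulative rho a s) (fun a => cumulative rho a t));
        apply is_derive_cumulative; auto.
    + intros x Hx. left. apply H; [easy|]. apply Rabs_le_between in Ha.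
      revert Hx. unfold Rmin, Rmax. destruct (Rle_dec 0 a); lra.
  - rewrite Rminus_0_r. replace eps with (eps / 2 * 2) at 2 by field.
    apply Rmult_le_compat_l; lra.
Qed.

(** Differentiation under the integral sign followed by integration of the conservation law in
    space; [J] is the flux. *)
Lemma is_derive_cumulative_time (rho rt J : R -> R -> R) (a t : R) :
  (forall x s, 0 <= s -> cont2_at rho x s) ->
  (forall x s, 0 < s -> is_derive (fun s => rho x s) s (rt x s)) ->
  (forall x s, 0 < s -> cont2_at rt x s) ->
  (forall x s, 0 < s -> is_derive (fun y => J y s) x (- rt x s)) -> 0 < t ->
  is_derive (fun s => cumulative rho a s) t (J 0 t - J a t).
Proof.
  intros Hc Hrt Hct HJ Ht.
  assert (near : locally t (fun s => 0 < s)) by (now apply (open_gt 0)).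
  assert (E : RInt (fun y => Derive (fun s => rho y s) t) 0 a = J 0 t - J a t).
  { rewrite (RInt_ext _ (fun y => rt y t)) by (intros y _; now apply is_derive_unique, Hrt).
    apply is_RInt_unique.
    replace (J 0 t - J a t) with (minus (- J a t) (- J 0 t))
      by (unfold minus, plus, opp; simpl; ring).
    apply (@is_RInt_derive R_CompleteNormedModule (fun y => - J y t) (fun y => rt y t)).
    - intros y _. rewrite <- (Ropp_involutive (rt y t)).
      apply (is_derive_opp (fun y => J y t)). now apply HJ.
    - intros y _. now apply cont2_at_slice, Hct. }
  rewrite <- E.
  apply (is_derive_RInt_param (fun s y => rho y s) 0 a t).
  - apply (filter_imp (fun s => 0 < s)); [|easy].
    intros s Hs y _. exists (rt y s). now apply Hrt.
  - intros y _ eps. destruct (Hct y t Ht eps (cond_pos eps)) as (d & Hd & H).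
    (* The bound by [t] keeps nearby times positive, where [rt] is the time derivative. *)
    assert (Hm : 0 < Rmin d t) by (now apply Rmin_glb_lt).
    exists (mkposreal _ Hm). simpl. intros s z Hs Hz.
    assert (H1 := Rmin_l d t). assert (H2 := Rmin_r d t).
    assert (0 < s) by (apply Rabs_def2 in Hs; lra).
    assert (D : forall x r, 0 < r -> Derive (fun s => rho x s) r = rt x r)
      by (intros x r Hr; now apply is_derive_unique, Hrt).
    change (Rabs (Derive (fun s => rho z s) s - Derive (fun s => rho y s) t) < eps).
    rewrite !D by easy. apply H; lra.
  - apply (filter_imp (fun s => 0 < s)); [|easy].
    intros s Hs. apply ex_RInt_cont. intros y. apply cont2_at_slice, Hc. lra.
Qed.

(** The constants 2 are chosen to cover all the maps used below: 0, [x], [z], their opposites,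
    [x + z] and [x - z]. *)
Definition argument_map (l : R -> R -> R) : Prop :=
  (forall x z, 0 <= x <= 1 -> 0 <= z <= 1 -> Rabs (l x z) <= 2) /\
  (forall x x' z z', Rabs (l x z - l x' z') <= 2 * (Rabs (x - x') + Rabs (z - z'))).

(** With two positive and two negative terms the flux at 0 cancels, so the time derivative of [F] is
    minus the same combination of fluxes at the four points. *)
Lemma four_point_principle (rho J : R -> R -> R) (X : R) (l1 l2 l3 l4 : R -> R -> R) :
  let V := cumulative rho in
  let F x z t := V (l1 x z) t + V (l2 x z) t - V (l3 x z) t - V (l4 x z) t in
  0 <= X <= 1 ->
  argument_map l1 -> argument_map l2 -> argument_map l3 -> argument_map l4 ->
  (forall x s, 0 <= s -> cont2_at rho x s) ->
  (forall a t, 0 < t -> is_derive (fun s => V a s) t (J 0 t - J a t)) ->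
  (forall x z, 0 <= x <= X -> 0 <= z <= 1 -> 0 <= F x z 0) ->
  (forall x z t, 0 <= x <= X -> 0 <= z <= 1 -> 0 < t -> F x z t < 0 ->
     (forall x' z', 0 <= x' <= X -> 0 <= z' <= 1 -> F x z t <= F x' z' t) ->
     J (l1 x z) t + J (l2 x z) t - J (l3 x z) t - J (l4 x z) t <= 0) ->
  forall x z t, 0 <= x <= X -> 0 <= z <= 1 -> 0 <= t -> 0 <= F x z t.
Proof.
  intros V F HX A1 A2 A3 A4 Hc Hder Hinit Hcrit.
  apply minimum_principle; [lra| | |easy|].
  - intros t Ht. destruct (cumulative_lipschitz rho t) as (M & M0 & HM); [auto|].
    exists (8 * M). split; [lra|]. intros x x' z z' Hx Hx' Hz Hz'.
    assert (B : forall l, argument_map l ->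
      Rabs (V (l x z) t - V (l x' z') t) <= M * (2 * (Rabs (x - x') + Rabs (z - z')))).
    { intros l [L1 L2]. apply Rle_trans with (1 := HM _ _ (L1 x' z' ltac:(lra) ltac:(lra))
        (L1 x z ltac:(lra) ltac:(lra))). now apply Rmult_le_compat_l. }
    generalize (B l1 A1) (B l2 A2) (B l3 A3) (B l4 A4). unfold F.
    set (q := Rabs (x - x') + Rabs (z - z')).
    replace (8 * M * q) with (4 * (M * (2 * q))) by ring. intros. split_Rabs; lra.
  - intros t Ht eps Heps.
    destruct (cumulative_time_continuous rho t (eps / 4) Hc Ht ltac:(lra)) as (d & Hd & H).
    exists d. split; [easy|]. intros s Hs Hst x z Hx Hz.
    assert (B : forall l, argument_map l -> Rabs (V (l x z) s - V (l x z) t) <= eps / 4).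
    { intros l [L1 _]. apply H; [easy|easy|]. apply L1; lra. }
    generalize (B l1 A1) (B l2 A2) (B l3 A3) (B l4 A4). unfold F. intros. split_Rabs; lra.
  - intros x z t Hx Hz Ht HF Hm.
    exists (- (J (l1 x z) t + J (l2 x z) t - J (l3 x z) t - J (l4 x z) t)).
    split; [generalize (Hcrit x z t Hx Hz Ht HF Hm); lra|].
    replace (- _) with (minus (minus (plus (J 0 t - J (l1 x z) t) (J 0 t - J (l2 x z) t))
       (J 0 t - J (l3 x z) t)) (J 0 t - J (l4 x z) t))
      by (unfold minus, plus, opp; simpl; ring).
    apply (@is_derive_minus R_AbsRing R_NormedModule (fun s => V (l1 x z) s + V (l2 x z) s - V (l3 x z) s)); [|now apply Hder].
    apply (@is_derive_minus R_AbsRing R_NormedModule (fun s => V (l1 x z) s + V (l2 x z) s)); [|now apply Hder].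
    apply (@is_derive_plus R_AbsRing R_NormedModule (fun s => V (l1 x z) s)); now apply Hder.
Qed.

(** * Periodicity, tests at extrema and reflection *)

(** Subtracting the integer part of [y] works for all periodic functions at once, so an extremum
    over [[0, 1]] becomes one over the line. *)
Lemma periodic1_reduce (y : R) :
  exists y', 0 <= y' <= 1 /\ forall f, periodic1 f -> f y = f y'.
Proof.
  assert (shift : forall n f, periodic1 f -> forall x, f (x + INR n) = f x).
  { intros n f Hf. induction n as [|n IH]; intros x.
    - simpl. now rewrite Rplus_0_r.
    - rewrite S_INR, <- (IH x), <- (Hf (x + INR n)). f_equal; ring. }
  destruct (archimed y) as [H1 H2].
  exists (y - IZR (up y - 1)). rewrite minus_IZR. split; [lra|].
  intros f Hf. rewrite <- minus_IZR. set (n := (up y - 1)%Z).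
  destruct (Z_le_gt_dec 0 n) as [Hn|Hn].
  - rewrite <- (shift (Z.to_nat n) f Hf (y - IZR n)), INR_IZR_INZ, Z2Nat.id by easy.
    f_equal; ring.
  - rewrite <- (shift (Z.to_nat (- n)) f Hf y), INR_IZR_INZ, Z2Nat.id by lia.
    rewrite opp_IZR. f_equal; ring.
Qed.

Lemma derive_zero_at_minimum (f : R -> R) (a b x l : R) : a < x < b ->
  (forall y, a < y < b -> f x <= f y) -> is_derive f x l -> l = 0.
Proof.
  intros Hx Hm Hl. apply is_derive_Reals in Hl.
  pose (pr := exist _ l Hl : derivable_pt f x).
  rewrite <- (derive_pt_eq_0 f x l pr Hl).
  apply (deriv_minimum f a b x pr); [lra|lra|]. intros y H1 H2. now apply Hm.
Qed.

Lemma derive_nonneg_at_left_minimum (f : R -> R) (x l : R) :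
  (forall h, 0 <= h <= 1 -> f x <= f (x + h)) -> is_derive f x l -> 0 <= l.
Proof.
  intros Hm Hl. apply is_derive_Reals in Hl.
  destruct (Rle_lt_dec 0 l) as [|Hneg]; [easy|exfalso].
  destruct (Hl (- l / 2) ltac:(lra)) as [d Hd].
  set (h := Rmin (d / 2) 1).
  assert (Hh : 0 < h) by (apply Rmin_glb_lt; generalize (cond_pos d); lra).
  assert (Hh1 : h <= d / 2) by apply Rmin_l. assert (Hh2 : h <= 1) by apply Rmin_r.
  specialize (Hd h ltac:(lra)). rewrite Rabs_pos_eq in Hd by lra.
  specialize (Hd ltac:(lra)). apply Rabs_def2 in Hd.
  assert (0 <= (f (x + h) - f x) / h); [|lra].
  apply Rdiv_le_0_compat; [|easy]. generalize (Hm h ltac:(lra)). lra.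
Qed.

Lemma nonneg_increment (F f : R -> R) (a b : R) : a <= b ->
  (forall x, is_derive F x (f x)) -> (forall x, a <= x <= b -> 0 <= f x) -> F a <= F b.
Proof.
  intros Hab HF Hf. destruct (MVT_gen F a b f) as [y [Hy Heq]].
  - intros; apply HF.
  - intros x _. apply continuity_pt_filterlim. exact (is_derive_continuous _ _ _ (HF x)).
  - rewrite Rmin_left, Rmax_right in Hy by lra. generalize (Hf y Hy). nra.
Qed.

Lemma RInt_centered (f : R -> R) (c d : R) : (forall y, continuous f y) ->
  RInt f (c - d) (c + d) = RInt (fun s => f (c + s) + f (c - s)) 0 d.
Proof.
  intros Hf. rewrite (RInt_split f (c - d) c (c + d)) by (now apply ex_RInt_cont).
  assert (H1 : RInt f (c - d) c = RInt (fun s => f (c - s)) 0 d).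
  { rewrite RInt_reflect by (now apply ex_RInt_cont). now rewrite Rminus_0_r. }
  assert (H2 : RInt f c (c + d) = RInt (fun s => f (s + c)) 0 d).
  { rewrite RInt_shift by (now apply ex_RInt_cont). now rewrite Rplus_0_l, (Rplus_comm d c). }
  rewrite H1, H2. symmetry. rewrite Rplus_comm.
  apply is_RInt_unique.
  apply (is_RInt_ext (fun s => plus (f (s + c)) (f (c - s)))).
  { intros s _. rewrite (Rplus_comm s c). reflexivity. }
  apply (@is_RInt_plus R_NormedModule); apply (@RInt_correct R_CompleteNormedModule);
    apply ex_RInt_cont; intros s.
  - apply (continuous_ext (fun s => f (c + 1 * s))); [intros t; apply f_equal; ring|].
    now apply continuous_affine.
  - apply (continuous_ext (fun s => f (c + -1 * s))); [intros t; apply f_equal; ring|].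
    now apply continuous_affine.
Qed.

(* The parts of [x - r, x + r] outside [0, 1/2] are reflected back into it at 0 and 1/2; they land
   on disjoint subintervals because r <= 1/2, and each reflected pair contributes -2 k(x) >= 0. *)
Lemma odd_periodic_centered_integral (k : R -> R) (x r : R) :
  (forall y, continuous k y) -> (forall y, k (- y) = - k y) -> periodic1 k ->
  0 <= x <= 1/2 -> k x <= 0 -> (forall y, 0 <= y <= 1/2 -> k x <= k y) -> 0 <= r <= 1/2 ->
  0 <= RInt (fun s => k (x + s) + k (x - s) - 2 * k x) 0 r.
Proof.
  intros ck ko kp Hx Hkx Hmin Hr.
  pose (psi y := k y - k x).
  assert (cpsi : forall y, continuous psi y)
    by (intros y; apply (continuous_minus k (fun _ => k x)); [easy|apply continuous_const]).
  replace (RInt (fun s => k (x + s) + k (x - s) - 2 * k x) 0 r) with (RInt psi (x - r) (x + r)).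
  2:{ rewrite RInt_centered by easy. apply RInt_ext_le; [lra|]. intros s _. unfold psi. ring. }
  assert (centered : forall c d, 0 <= d -> (forall s, 0 <= psi (c + s) + psi (c - s)) ->
    0 <= RInt psi (c - d) (c + d)).
  { intros c d Hd H. rewrite RInt_centered by easy.
    apply RInt_ge_0; [easy| |auto]. apply ex_RInt_cont. intros s.
    apply (continuous_plus (fun s => psi (c + s)) (fun s => psi (c - s))).
    - apply (continuous_ext (fun s => psi (c + 1 * s))); [intros t; apply f_equal; ring|].
      now apply continuous_affine.
    - apply (continuous_ext (fun s => psi (c + -1 * s))); [intros t; apply f_equal; ring|].
      now apply continuous_affine. }
  assert (R0 : forall s, 0 <= psi (0 + s) + psi (0 - s)).
  { intros s. unfold psi. rewrite Rplus_0_l, Rminus_0_l, ko. lra. }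
  assert (R1 : forall s, 0 <= psi (1/2 + s) + psi (1/2 - s)).
  { intros s. unfold psi. replace (1/2 + s) with (- (1/2 - s) + 1) by field.
    rewrite kp, ko. lra. }
  assert (Left : 0 <= RInt psi (x - r) (Rabs (x - r))).
  { destruct (Rle_lt_dec 0 (x - r)).
    - rewrite Rabs_pos_eq by easy. rewrite (RInt_point (x - r) psi). apply Rle_refl.
    - rewrite Rabs_left by easy.
      generalize (centered 0 (r - x) ltac:(lra) R0).
      replace (0 - (r - x)) with (x - r) by ring.
      replace (0 + (r - x)) with (- (x - r)) by ring. easy. }
  assert (Right : 0 <= RInt psi (Rmin (x + r) (1 - (x + r))) (x + r)).
  { destruct (Rle_lt_dec (x + r) (1/2)).
    - rewrite Rmin_left by lra. rewrite (RInt_point (x + r) psi). apply Rle_refl.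
    - rewrite Rmin_right by lra.
      generalize (centered (1/2) (x + r - 1/2) ltac:(lra) R1).
      replace (1/2 - (x + r - 1/2)) with (1 - (x + r)) by field.
      replace (1/2 + (x + r - 1/2)) with (x + r) by field. easy. }
  assert (Mid : 0 <= RInt psi (Rabs (x - r)) (Rmin (x + r) (1 - (x + r)))).
  { apply RInt_ge_0; [|now apply ex_RInt_cont|].
    - apply Rmin_glb; split_Rabs; lra.
    - intros y [H1 H2]. unfold psi.
      assert (y < x + r) by (apply Rlt_le_trans with (1 := H2); apply Rmin_l).
      assert (y < 1 - (x + r)) by (apply Rlt_le_trans with (1 := H2); apply Rmin_r).
      generalize (Rabs_pos (x - r)) (Hmin y). lra. }
  rewrite (RInt_split psi (x - r) (Rabs (x - r)) (x + r)) by (now apply ex_RInt_cont).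
  rewrite (RInt_split psi (Rabs (x - r)) (Rmin (x + r) (1 - (x + r))) (x + r))
    by (now apply ex_RInt_cont).
  lra.
Qed.

(** * The solution at a fixed time *)

(** Here [f] is the density, [V] a primitive of it, [M] the mass of one period and [u] the
    velocity. *)
Record slice (alpha c M : R) (f df V u : R -> R) : Prop := {
  slice_alpha : 0 < alpha < 2;
  slice_c : 0 < c;
  slice_periodic : periodic1 f;
  slice_derive : forall y, is_derive f y (df y);
  slice_derive_continuous : forall y, continuous df y;
  slice_primitive : forall y, is_derive V y (f y);
  slice_primitive_periodic : forall y, V (y + 1) = V y + M;
  slice_velocity : forall x, velocity_is alpha c f x (u x) }.

Lemma slice_combination (alpha c M : R) (f df V u : R -> R) (p1 p2 p3 a1 a2 a3 : R) :
  slice alpha c M f df V u ->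
  (forall s, 0 <= s <= 1/2 -> 0 <= p1 * second_difference V a1 s
     + p2 * second_difference V a2 s + p3 * second_difference V a3 s) ->
  p1 * u a1 + p2 * u a2 + p3 * u a3 <= 0.
Proof.
  intros [] H. apply (velocity_combination alpha c M p1 p2 p3 a1 a2 a3 f df V u); auto.
  intros r Hr. apply RInt_ge_0; [lra| |intros s Hs; apply H; lra].
  apply ex_RInt_cont. intros s.
  assert (Q : forall a p, continuous (fun s => p * second_difference V a s) s).
  { intros a p. apply (continuous_scal_r (K := R_AbsRing) (V := R_NormedModule)).
    eapply is_derive_continuous. apply is_derive_second_difference. apply slice_primitive0. }
  apply (continuous_plus (fun s => p1 * second_difference V a1 s + p2 * second_difference V a2 s)
    (fun s => p3 * second_difference V a3 s)); [|apply Q].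
  apply (continuous_plus (fun s => p1 * second_difference V a1 s)); apply Q.
Qed.

(** The second differences of [V] at [x + 1] and at [x] coincide, so the weights [1, -1] and [-1, 1]
    give the two opposite inequalities. *)
Lemma slice_velocity_periodic (alpha c M : R) (f df V u : R -> R) :
  slice alpha c M f df V u -> periodic1 u.
Proof.
  intros HS x.
  assert (E : forall s, second_difference V (x + 1) s = second_difference V x s).
  { intros s. unfold second_difference. destruct HS.
    replace (x + 1 + s) with (x + s + 1) by ring. replace (x + 1 - s) with (x - s + 1) by ring.
    rewrite !slice_primitive_periodic0. ring. }
  assert (H1 := slice_combination alpha c M f df V u 1 (-1) 0 (x + 1) x 0 HS).
  assert (H2 := slice_combination alpha c M f df V u (-1) 1 0 (x + 1) x 0 HS).
  apply Rle_antisym.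
  - enough (1 * u (x + 1) + -1 * u x + 0 * u 0 <= 0) by lra.
    apply H1. intros s _. rewrite E. lra.
  - enough (-1 * u (x + 1) + 1 * u x + 0 * u 0 <= 0) by lra.
    apply H2. intros s _. rewrite E. lra.
Qed.

Lemma cumulative_add_1 (rho : R -> R -> R) (t : R) : (forall x, cont2_at rho x t) ->
  (forall x, rho (x + 1) t = rho x t) ->
  forall y, cumulative rho (y + 1) t = cumulative rho y t + cumulative rho 1 t.
Proof.
  intros Hc Hp y. unfold cumulative.
  assert (ex : forall a b, ex_RInt (fun y => rho y t) a b)
    by (intros; apply ex_RInt_cont; intros x; now apply cont2_at_slice).
  rewrite (RInt_split (fun y => rho y t) 0 1 (y + 1)) by auto.
  rewrite Rplus_comm. f_equal.
  replace (RInt (fun y => rho y t) 1 (y + 1)) with (RInt (fun y => rho y t) (0 + 1) (y + 1))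
    by (f_equal; ring).
  rewrite <- (RInt_shift (fun y => rho y t) 1 0 y) by auto. apply RInt_ext. intros s _. apply Hp.
Qed.

(** * Propagation of sign and symmetry *)

Ltac derive_from HV :=
  auto_derive;
  [ repeat split; eexists; apply HV
  | rewrite ?(is_derive_unique _ _ _ (HV _));
    match goal with |- @eq _ ?a ?b => change (@eq R a b) end; unfold Rminus; ring ].

Definition flux (rho u : R -> R -> R) (y t : R) : R := rho y t * u y t.

(** The evolution enters only in integrated form: the mass over [[0, a]] changes by the flux at 0
    minus the flux at [a]. *)
Record flow (alpha c : R) (rho u : R -> R -> R) : Prop := {
  flow_continuous : forall x t, 0 <= t -> cont2_at rho x t;
  flow_slice : forall t, 0 <= t -> exists df,
    slice alpha c (cumulative rho 1 t) (fun y => rho y t) df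
      (fun y => cumulative rho y t) (fun y => u y t);
  flow_conservation : forall a t, 0 < t ->
    is_derive (fun s => cumulative rho a s) t (flux rho u 0 t - flux rho u a t) }.

Lemma classical_solution_flow (alpha c : R) (rho0 : R -> R) (rho u : R -> R -> R) :
  0 < alpha < 2 -> 0 < c -> classical_solution alpha c rho0 rho u -> flow alpha c rho u.
Proof.
  intros Ha Hc (_ & Hp & Hcont & (rx & Hrx & Crx) & (rt & Hrt & Crt) & Hu & Heq).
  split; [easy| |].
  - intros t Ht. exists (fun y => rx y t). split; auto.
    + intros x. now apply Hp.
    + intros y. apply is_derive_Reals. now apply Hrx.
    + intros y. now apply cont2_at_slice, Crx.
    + apply is_derive_cumulative. auto.
    + apply cumulative_add_1; auto.
  - intros a t Ht. apply (is_derive_cumulative_time rho rt (flux rho u)); auto.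
    + intros x s Hs. apply is_derive_Reals. now apply Hrt.
    + intros x s Hs. destruct (Heq x s Hs) as (p & q & H1 & H2 & H3).
      replace (- rt x s) with q; [now apply is_derive_Reals|].
      rewrite (uniqueness_limite _ _ _ _ (Hrt x s Hs) H1). lra.
Qed.

Ltac argument_map_tac :=
  split; [intros x z Hx Hz; apply Rabs_le_between; lra
         |intros x x' z z'; split_Rabs; lra].

(** At a negative minimum of [V (x + z) - V x], the derivative in [z] gives density 0 at [x + z],
    and the derivative in [x] then gives density 0 at [x]. Both fluxes vanish. The two terms at 0
    only complete the four-point form. *)
Lemma flow_nonneg (alpha c : R) (rho u : R -> R -> R) :
  flow alpha c rho u -> (forall x, 0 <= rho x 0) ->
  forall x t, 0 <= t -> 0 <= rho x t.
Proof.
  intros [Hc HS Hder] Hinit.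
  assert (HZ : forall x z t, 0 <= x <= 1 -> 0 <= z <= 1 -> 0 <= t ->
    0 <= cumulative rho (x + z) t + cumulative rho 0 t - cumulative rho x t - cumulative rho 0 t).
  { apply (four_point_principle rho (flux rho u) 1 (fun x z => x + z) (fun _ _ => 0)
      (fun x _ => x) (fun _ _ => 0)); auto; try argument_map_tac; [lra| |].
    - intros x z Hx Hz.
      generalize (nonneg_increment (fun a => cumulative rho a 0) (fun y => rho y 0) x (x + z)
        ltac:(lra) (is_derive_cumulative rho 0 (fun y => Hc y 0 (Rle_refl 0)))
        (fun y _ => Hinit y)). lra.
    - intros x z t Hx Hz Ht Hneg Hmin. destruct (HS t ltac:(lra)) as [df HSt].
      assert (HV := slice_primitive _ _ _ _ _ _ _ HSt).
      assert (VP := slice_primitive_periodic _ _ _ _ _ _ _ HSt).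
      assert (fP := slice_periodic _ _ _ _ _ _ _ HSt).
      assert (uP := slice_velocity_periodic _ _ _ _ _ _ _ HSt).
      cbv beta in *. unfold flux.
      (* At [z = 1] both end points carry the same flux by periodicity; at [z = 0] the increment is
         0 and cannot be negative. *)
      destruct (Rle_lt_or_eq_dec _ _ (proj2 Hz)) as [Hz1| ->].
      2:{ rewrite fP, uP. lra. }
      destruct (Rle_lt_or_eq_dec _ _ (proj1 Hz)) as [Hz0| <-].
      2:{ rewrite Rplus_0_r in Hneg. lra. }
      set (V := fun y => cumulative rho y t) in *.
      assert (E1 : rho (x + z) t = 0).
      { apply (derive_zero_at_minimum (fun z => V (x + z)) 0 1 z); [lra| |].
        - intros z' Hz'. generalize (Hmin x z' Hx ltac:(lra)). unfold V. lra.
        - derive_from HV. }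
      assert (E2 : rho (x + z) t - rho x t = 0).
      { apply (derive_zero_at_minimum (fun x => V (x + z) - V x) (x - 1) (x + 1) x); [lra| |].
        - intros y _. destruct (periodic1_reduce y) as (y' & Hy' & Hred).
          rewrite (Hred (fun x => V (x + z) - V x)).
          + generalize (Hmin y' z Hy' Hz). unfold V. lra.
          + intros w. replace (w + 1 + z) with (w + z + 1) by ring. unfold V. rewrite !VP. ring.
        - derive_from HV. }
      replace (rho x t) with 0 by lra. rewrite E1. lra. }
  intros x t Ht. destruct (HS t Ht) as [df HSt].
  destruct (periodic1_reduce x) as (x' & Hx' & Hred).
  rewrite (Hred (fun y => rho y t)) by (exact (slice_periodic _ _ _ _ _ _ _ HSt)).
  apply (derive_nonneg_at_left_minimum (fun a => cumulative rho a t) x').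
  - intros h Hh. generalize (HZ x' h t Hx' Hh Ht). lra.
  - apply (slice_primitive _ _ _ _ _ _ _ HSt).
Qed.

(** Put [w y = V y + V (- y)]. A minimum of [w z - w x] has [z] minimising and [x] maximising [w].
    At both points the density takes equal values at the point and its mirror image, and the sum of
    the two velocities is at most 0 at [z] and at least 0 at [x]. Hence [w] is constant, equal to
    [w 0 = 0]. *)
Lemma flow_even (alpha c : R) (rho u : R -> R -> R) :
  flow alpha c rho u -> (forall x t, 0 <= t -> 0 <= rho x t) ->
  (forall x, rho (- x) 0 = rho x 0) ->
  forall y t, 0 <= t -> cumulative rho (- y) t = - cumulative rho y t.
Proof.
  intros [Hc HS Hder] Hpos Hinit.
  assert (HW : forall x z t, 0 <= x <= 1 -> 0 <= z <= 1 -> 0 <= t ->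
    0 <= cumulative rho z t + cumulative rho (- z) t - cumulative rho x t - cumulative rho (- x) t).
  { apply (four_point_principle rho (flux rho u) 1 (fun _ z => z) (fun _ z => - z)
      (fun x _ => x) (fun x _ => - x)); auto; try argument_map_tac; [lra| |].
    - assert (W0 : forall y, cumulative rho y 0 + cumulative rho (- y) 0 = 0).
      { intros y. destruct (HS 0 (Rle_refl 0)) as [df HSt].
        assert (HV := slice_primitive _ _ _ _ _ _ _ HSt). cbv beta in HV.
        set (V := fun y => cumulative rho y 0) in *.
        assert (B := derive_bound_increment (fun y => V y + V (- y))
          (fun y => rho y 0 - rho (- y) 0) 0 y 0).
        assert (B' : Rabs (V y + V (- y) - (V 0 + V (- 0))) <= 0 * Rabs (y - 0)).
        { apply B.
          - intros x. derive_from HV.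
          - intros x _. rewrite Hinit, Rminus_diag_eq, Rabs_R0 by easy. lra. }
        unfold V in B'. rewrite Ropp_0, cumulative_0 in B'. fold V in B'.
        rewrite Rmult_0_l in B'.
        assert (B2 := Rabs_pos (V y + V (- y) - (0 + 0))). unfold V in *.
        split_Rabs; lra. }
      intros x z _ _. generalize (W0 x) (W0 z). lra.
    - intros x z t Hx Hz Ht Hneg Hmin. destruct (HS t ltac:(lra)) as [df HSt].
      assert (HV := slice_primitive _ _ _ _ _ _ _ HSt).
      assert (VP := slice_primitive_periodic _ _ _ _ _ _ _ HSt).
      cbv beta in *. unfold flux. clear Hneg.
      set (V := fun y => cumulative rho y t) in *.
      assert (dw : forall y, is_derive (fun y => V y + V (- y)) y (rho y t - rho (- y) t))
        by (intros y; derive_from HV).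
      assert (wP : periodic1 (fun y => V y + V (- y))).
      { intros y. replace (V (- y)) with (V (- (y + 1) + 1)) by (f_equal; ring).
        unfold V. rewrite !VP. ring. }
      assert (wmin : forall y, V z + V (- z) <= V y + V (- y)).
      { intros y. destruct (periodic1_reduce y) as (y' & Hy' & Hred).
        rewrite (Hred _ wP). generalize (Hmin x y' Hx Hy'). unfold V. lra. }
      assert (wmax : forall y, V y + V (- y) <= V x + V (- x)).
      { intros y. destruct (periodic1_reduce y) as (y' & Hy' & Hred).
        rewrite (Hred _ wP). generalize (Hmin y' z Hy' Hz). unfold V. lra. }
      assert (Ez : rho z t - rho (- z) t = 0).
      { apply (derive_zero_at_minimum (fun y => V y + V (- y)) (z - 1) (z + 1) z);
          [lra|auto|apply dw]. }
      assert (Ex : - (rho x t - rho (- x) t) = 0).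
      { apply (derive_zero_at_minimum (fun y => - (V y + V (- y))) (x - 1) (x + 1) x); [lra| |].
        - intros y _. generalize (wmax y). lra.
        - apply (is_derive_opp (fun y => V y + V (- y))). apply dw. }
      assert (Uz : 1 * u z t + 1 * u (- z) t + 0 * u 0 t <= 0).
      { apply (slice_combination _ _ _ _ _ _ _ 1 1 0 z (- z) 0 HSt). intros s _.
        unfold second_difference. fold V.
        generalize (wmin (z + s)) (wmin (z - s)).
        replace (- (z + s)) with (- z - s) by ring. replace (- (z - s)) with (- z + s) by ring.
        unfold V. lra. }
      assert (Ux : -1 * u x t + -1 * u (- x) t + 0 * u 0 t <= 0).
      { apply (slice_combination _ _ _ _ _ _ _ (-1) (-1) 0 x (- x) 0 HSt). intros s _.
        unfold second_difference. fold V.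
        generalize (wmax (x + s)) (wmax (x - s)).
        replace (- (x + s)) with (- x - s) by ring. replace (- (x - s)) with (- x + s) by ring.
        unfold V. lra. }
      assert (Pz := Hpos z t ltac:(lra)). assert (Px := Hpos x t ltac:(lra)).
      replace (rho (- z) t) with (rho z t) by lra. replace (rho (- x) t) with (rho x t) by lra.
      assert (rho z t * (u z t + u (- z) t) <= 0) by nra.
      assert (0 <= rho x t * (u x t + u (- x) t)) by nra.
      lra. }
  intros y t Ht. destruct (HS t Ht) as [df HSt].
  assert (VP := slice_primitive_periodic _ _ _ _ _ _ _ HSt). cbv beta in VP.
  set (V := fun y => cumulative rho y t) in *.
  assert (wP : periodic1 (fun y => V y + V (- y))).
  { intros z. replace (V (- z)) with (V (- (z + 1) + 1)) by (f_equal; ring).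
    unfold V. rewrite !VP. ring. }
  destruct (periodic1_reduce y) as (y' & Hy' & Hred). specialize (Hred _ wP). unfold V in Hred.
  generalize (HW 0 y' t ltac:(lra) Hy' Ht) (HW y' 0 t Hy' ltac:(lra) Ht).
  rewrite Ropp_0, cumulative_0. cbv beta in Hred. lra.
Qed.

(** For fixed [z] the function [k] of the base point is odd and periodic, so it vanishes at 0 and
    [1/2] and a negative minimum is interior. Criticality in [x] and in [z] forces equal densities
    at [x + z], [x - z] and [x], and the flux combination is this density times a combination of
    velocities that is at most 0. *)
Lemma flow_second_difference_nonneg (alpha c : R) (rho u : R -> R -> R) :
  flow alpha c rho u -> (forall x t, 0 <= t -> 0 <= rho x t) ->
  (forall y t, 0 <= t -> cumulative rho (- y) t = - cumulative rho y t) ->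
  (forall x z, 0 <= x <= 1/2 -> 0 <= z <= 1 ->
     0 <= second_difference (fun y => cumulative rho y 0) x z) ->
  forall x z t, 0 <= x <= 1/2 -> 0 <= z <= 1 -> 0 <= t ->
    0 <= second_difference (fun y => cumulative rho y t) x z.
Proof.
  intros [Hc HS Hder] Hpos Hodd Hinit x z t Hx Hz Ht.
  enough (HW : forall x z t, 0 <= x <= 1/2 -> 0 <= z <= 1 -> 0 <= t ->
    0 <= cumulative rho (x + z) t + cumulative rho (x - z) t
       - cumulative rho x t - cumulative rho x t).
  { unfold second_difference. generalize (HW x z t Hx Hz Ht). lra. }
  clear x z t Hx Hz Ht.
  apply (four_point_principle rho (flux rho u) (1/2) (fun x z => x + z) (fun x z => x - z)
      (fun x _ => x) (fun x _ => x)); auto; try argument_map_tac; [lra| |].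
  - intros x z Hx Hz. generalize (Hinit x z Hx Hz). unfold second_difference. lra.
  - intros x z t Hx Hz Ht Hneg Hmin. destruct (HS t ltac:(lra)) as [df HSt].
    assert (HV := slice_primitive _ _ _ _ _ _ _ HSt).
    assert (VP := slice_primitive_periodic _ _ _ _ _ _ _ HSt).
    assert (VO : forall y, cumulative rho (- y) t = - cumulative rho y t)
      by (intros y; apply Hodd; lra).
    cbv beta in *. unfold flux. clear Hinit.
    set (V := fun y => cumulative rho y t) in *.
    assert (dV : forall y, cumulative rho y t = V y) by easy.
    rewrite !dV in Hneg. rewrite dV in VP.
    assert (VP' : forall y, V (y + 1) = V y + V 1) by exact VP.
    assert (VO' : forall y, V (- y) = - V y) by exact VO.
    assert (Hmin' : forall x' z', 0 <= x' <= 1/2 -> 0 <= z' <= 1 ->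
      V (x + z) + V (x - z) - V x - V x <= V (x' + z') + V (x' - z') - V x' - V x')
      by exact Hmin.
    clearbody V. clear VP VO Hmin dV Hodd.
    pose (k y := V (y + z) + V (y - z) - 2 * V y).
    assert (dk : forall y, is_derive k y (rho (y + z) t + rho (y - z) t - 2 * rho y t))
      by (intros y; unfold k; derive_from HV).
    assert (ko : forall y, k (- y) = - k y).
    { intros y. unfold k. replace (- y + z) with (- (y - z)) by ring.
      replace (- y - z) with (- (y + z)) by ring. rewrite !VO'. ring. }
    assert (kp : periodic1 k).
    { intros y. unfold k. replace (y + 1 + z) with (y + z + 1) by ring.
      replace (y + 1 - z) with (y - z + 1) by ring. rewrite !VP'. ring. }
    assert (Hk : k x < 0) by (unfold k; lra).
    assert (k0 : k 0 = 0) by (generalize (ko 0); rewrite Ropp_0; lra).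
    assert (k2 : k (1/2) = 0).
    { generalize (ko (1/2)) (kp (- (1/2))). replace (- (1/2) + 1) with (1/2) by field. lra. }
    assert (Hx0 : 0 < x) by (destruct (Rle_lt_or_eq_dec _ _ (proj1 Hx)) as [|<-]; [easy|lra]).
    assert (Hx1 : x < 1/2) by (destruct (Rle_lt_or_eq_dec _ _ (proj2 Hx)) as [| ->]; [easy|lra]).
    assert (Hz0 : 0 < z).
    { destruct (Rle_lt_or_eq_dec _ _ (proj1 Hz)) as [|<-]; [easy|].
      unfold k in Hk. rewrite Rplus_0_r, Rminus_0_r in Hk. lra. }
    assert (Hz1 : z < 1).
    { destruct (Rle_lt_or_eq_dec _ _ (proj2 Hz)) as [| ->]; [easy|].
      unfold k in Hk. rewrite VP' in Hk.
      generalize (VP' (x - 1)). replace (x - 1 + 1) with x by ring. lra. }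
    assert (kmin : forall y, 0 <= y <= 1/2 -> k x <= k y).
    { intros y Hy. generalize (Hmin' y z Hy Hz). unfold k. lra. }
    assert (Ex : rho (x + z) t + rho (x - z) t - 2 * rho x t = 0).
    { apply (derive_zero_at_minimum k 0 (1/2) x); [lra| |apply dk].
      intros y Hy. apply kmin. lra. }
    assert (Ez : rho (x + z) t - rho (x - z) t = 0).
    { apply (derive_zero_at_minimum (fun z => V (x + z) + V (x - z)) 0 1 z); [lra| |].
      - intros z' Hz'. generalize (Hmin' x z' Hx ltac:(lra)). lra.
      - derive_from HV. }
    assert (U : 1 * u (x + z) t + 1 * u (x - z) t + -2 * u x t <= 0).
    { destruct HSt.
      apply (velocity_combination alpha c (V 1) 1 1 (-2) (x + z) (x - z) x
        (fun y => rho y t) df V (fun y => u y t)); auto.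
      intros r Hr.
      (* Differences in [s] and in [z] commute. As [x] minimises [k] only over [[0, 1/2]], the
         integrand itself may change sign, and the integrated criterion of [velocity_combination] is
         used. *)
      rewrite (RInt_ext_le _ (fun s => k (x + s) + k (x - s) - 2 * k x)); [|lra|].
        + apply odd_periodic_centered_integral; auto; [|lra].
          intros y. exact (is_derive_continuous _ _ _ (dk y)).
        + intros s _. unfold second_difference, k.
          replace (x + z + s) with (x + s + z) by ring. replace (x + z - s) with (x - s + z) by ring.
          replace (x - z + s) with (x + s - z) by ring. replace (x - z - s) with (x - s - z) by ring.
          ring. }
    assert (Pz := Hpos x t ltac:(lra)).
    replace (rho (x + z) t) with (rho x t) by lra. replace (rho (x - z) t) with (rho x t) by lra.
    nra.
Qed.

(** * The initial datum and the conclusion *)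

(** For [z <= 1/2], evenness and periodicity fold [x - z] and [x + z] into [[0, 1/2]], where the
    image of [x - z] lies to the left, so the second difference increases in [z] from 0. It is
    unchanged under [z -> 1 - z], which gives the other half. *)
Lemma initial_second_difference_nonneg (f V : R -> R) :
  periodic1 f -> (forall x, f (- x) = f x) ->
  (forall x y, 0 <= x -> x <= y -> y <= 1/2 -> f x <= f y) ->
  (forall y, is_derive V y (f y)) -> (forall y, V (y + 1) = V y + V 1) ->
  forall x z, 0 <= x <= 1/2 -> 0 <= z <= 1 -> 0 <= second_difference V x z.
Proof.
  intros fP fE fM HV VP.
  assert (close : forall x z, 0 <= x <= 1/2 -> 0 <= z <= 1/2 -> f (x - z) <= f (x + z)).
  { intros x z Hx Hz.
    assert (E1 : f (x - z) = f (Rabs (x - z))).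
    { unfold Rabs. destruct (Rcase_abs (x - z)); [now rewrite fE|easy]. }
    rewrite E1. destruct (Rle_lt_dec (x + z) (1/2)).
    - apply fM; split_Rabs; lra.
    - assert (E2 : f (x + z) = f (1 - (x + z))).
      { rewrite <- (fE (x + z)), <- (fP (- (x + z))). f_equal; ring. }
      rewrite E2. apply fM; split_Rabs; lra. }
  assert (half : forall x z, 0 <= x <= 1/2 -> 0 <= z <= 1/2 -> 0 <= second_difference V x z).
  { intros x z Hx Hz.
    replace 0 with (second_difference V x 0)
      by (unfold second_difference; rewrite Rplus_0_r, Rminus_0_r; ring).
    apply (nonneg_increment (second_difference V x) (fun s => f (x + s) - f (x - s))); [lra| |].
    - intros s. now apply is_derive_second_difference.
    - intros s Hs. generalize (close x s Hx ltac:(lra)). lra. }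
  intros x z Hx Hz. destruct (Rle_lt_dec z (1/2)); [apply half; lra|].
  replace (second_difference V x z) with (second_difference V x (1 - z)); [apply half; lra|].
  unfold second_difference.
  replace (x + (1 - z)) with (x - z + 1) by ring. rewrite VP.
  generalize (VP (x - (1 - z))). replace (x - (1 - z) + 1) with (x + z) by ring. lra.
Qed.

Theorem theorem2p6 (alpha c rhomax : R) (rho0 : R -> R) (rho u : R -> R -> R) :
  0 < alpha < 2 ->
  0 < c ->
  smooth rho0 ->
  periodic1 rho0 ->
  (forall x, rho0 (- x) = rho0 x) ->
  0 < rhomax ->
  (forall x, 0 <= rho0 x <= rhomax) ->
  rho0 0 = 0 ->
  (forall x l, 0 <= x <= 1/2 -> derivable_pt_lim rho0 x l -> 0 <= l) ->
  classical_solution alpha c rho0 rho u ->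
  forall x t, 0 <= x <= delta alpha -> 0 <= t -> u x t <= 0.
Proof.
  intros Ha Hc (d & <- & Hd) Hper Heven _ Hbd _ Hmono Hsol x t Hx Ht.
  assert (Hflow := classical_solution_flow _ _ _ _ _ Ha Hc Hsol).
  destruct Hsol as (Hinit & _).
  assert (Hpos : forall x t, 0 <= t -> 0 <= rho x t).
  { apply (flow_nonneg alpha c rho u Hflow). intros y. rewrite Hinit. apply Hbd. }
  assert (Hodd : forall y t, 0 <= t -> cumulative rho (- y) t = - cumulative rho y t).
  { apply (flow_even alpha c rho u Hflow Hpos). intros y. rewrite !Hinit. apply Heven. }
  assert (HS0 : forall x z, 0 <= x <= 1/2 -> 0 <= z <= 1 ->
    0 <= second_difference (fun y => cumulative rho y 0) x z).
  { destruct (flow_slice _ _ _ _ Hflow 0 (Rle_refl 0)) as [df HSt].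
    apply (initial_second_difference_nonneg (d 0%nat)); try easy.
    - intros a b H1 H2 H3.
      destruct (MVT_gen (d 0%nat) a b (d 1%nat)) as [y [Hy Heq]].
      + intros y _. apply is_derive_Reals. apply Hd.
      + intros y _. apply derivable_continuous_pt. exists (d 1%nat y). apply Hd.
      + rewrite Rmin_left, Rmax_right in Hy by lra.
        generalize (Hmono y (d 1%nat y) ltac:(lra) (Hd 0%nat y)). nra.
    - intros y. rewrite <- Hinit. exact (slice_primitive _ _ _ _ _ _ _ HSt y).
    - exact (slice_primitive_periodic _ _ _ _ _ _ _ HSt). }
  assert (Hx' : 0 <= x <= 1/2).
  { generalize (Rmin_l (1/4) (Rpower (3 * Cconst alpha) (- (1 / (1 + alpha))))).
    fold (delta alpha). lra. }
  destruct (flow_slice _ _ _ _ Hflow t Ht) as [df HSt].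
  (* A single point with weight 1: the second differences of [V] at [x] are nonnegative, so the
     velocity there is at most 0. *)
  enough (1 * u x t + 0 * u 0 t + 0 * u 0 t <= 0) by lra.
  apply (slice_combination _ _ _ _ _ _ _ 1 0 0 x 0 0 HSt). intros s Hs.
  generalize (flow_second_difference_nonneg alpha c rho u Hflow Hpos Hodd HS0 x s t
    Hx' ltac:(lra) Ht). lra.
Qed.
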